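(* Let $f$ satisfy the standing assumptions, let $\beta>\mu^{-1}$, $c:=(3\beta L+1)\rho/6$ and $\Delta_0:=h_\beta(z_0)-\bar\Phi$. Let $\{z_k\}_{k\ge 0}$ be any sequence generated by the ACQRN method (described in the context) from $z_0\in\mathbb{R}^{n+m}$ with $\alpha_1=2\beta\rho$ and $\alpha_2=2(3\beta L+1)\rho$. Then there is $h^*\ge\bar\Phi$ such that $$h_\beta(z_k)\to h^*,\qquad \nabla h_\beta(z_k)\to 0,\qquad \liminf_{k\to\infty}\lambda_{\min}(\nabla^2 h_\beta(z_k))\ge 0 .$$ Furthermore, for any $T\ge 1$, $$\min_{k=1,\dots,T}\max\left\{\sqrt{\frac{\|\nabla h_\beta(z_k)\|}{c}},\;-\frac{\lambda_{\min}(\nabla^2 h_\beta(z_k))}{c}\right\}=O\left(\left[\frac{\Delta_0}{cT}\right]^{1/3}\right).$$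
   Context: Write $z=(x,y)\in\mathbb{R}^n\times\mathbb{R}^m=\mathbb{R}^{n+m}$. $\|\cdot\|$ is the Euclidean norm for vectors and the spectral norm for matrices; $\lambda_{\min}$ is the smallest eigenvalue of a symmetric matrix. Standing assumptions on $f:\mathbb{R}^n\times\mathbb{R}^m\to\mathbb{R}$: $f$ is thrice continuously differentiable; for each $x$, $f(x,\cdot)$ is $\mu$-strongly concave ($\mu>0$); for each $y$, $f(\cdot,y)$ is possibly nonconvex; for constants $L,\rho>0$, $\|\nabla f(z+\xi)-\nabla f(z)\|\le L\|\xi\|$ and $\|\nabla^2 f(z+\xi)-\nabla^2 f(z)\|\le\rho\|\xi\|$ for all $z,\xi\in\mathbb{R}^{n+m}$; and with $\Phi(x):=\max_{y\in\mathbb{R}^m}f(x,y)$, $\bar\Phi:=\inf_{x}\Phi(x)>-\infty$. Regularized function: $h_\beta(z):=f(z)+\frac{\beta}{2}\|\nabla_y f(z)\|^2$. Set $P:=\begin{pmatrix}0&0\\0&I_m\end{pmatrix}\in\mathbb{R}^{(n+m)\times(n+m)}$ and $\bar H(z):=\nabla^2 f(z)+\beta\nabla^2 f(z)P\nabla^2 f(z)$. One has $\nabla h_\beta(z)=[I_{n+m}+\beta\nabla^2 f(z)P]\nabla f(z)$. ACQRN method: given $z_0$, for $k=0,1,2,\dots$ choose a global minimizer $$\xi_k\in\arg\min_{\xi\in\mathbb{R}^{n+m}}\ \nabla h_\beta(z_k)^\top\xi+\tfrac12\xi^\top\big(\bar H(z_k)+\alpha_1\|\nabla_y f(z_k)\|I_{n+m}\big)\xi+\tfrac{\alpha_2}{6}\|\xi\|^3$$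 and set $z_{k+1}=z_k+\xi_k$. The $O(\cdot)$ is with respect to $T$: the bound holds with a universal constant for all $T$ sufficiently large (depending on the problem and on $\beta,\Delta_0$), and with a problem-dependent constant for all $T\ge1$. *)

(* Defs.v *)
From HB Require Import structures.
From mathcomp Require Import all_boot all_order all_algebra.
From mathcomp Require Import boolp classical_sets reals ereal topology.
From mathcomp Require Import normedtype sequences derive exp.

Set Implicit Arguments.
Unset Strict Implicit.
Unset Printing Implicit Defensive.

Import Order.TTheory GRing.Theory Num.Theory.
Import numFieldNormedType.Exports.

Local Open Scope classical_set_scope.
Local Open Scope ring_scope.

(* Points of R^d are row vectors, and z = (x, y) in R^n x R^m is row_mx x y.
   The norm `|_| that the library puts on matrices is the sup norm, so the
   Euclidean and spectral norms are defined here; limits and differentiability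
   do not depend on this choice. *)

Section Euclidean.
Variables (R : realType) (d : nat).

Definition dot (u v : 'rV[R]_d) : R := (u *m v^T) 0 0.

Definition enorm (u : 'rV[R]_d) : R := Num.sqrt (dot u u).

(* v *m A^T is the row vector (A v^T)^T. *)
Definition spectral_norm (A : 'M[R]_d) : R :=
  sup [set enorm (v *m A^T) | v in [set v : 'rV[R]_d | enorm v <= 1]].

(* For a symmetric A and d > 0 the set below is finite and nonempty, so that
   inf is its minimum. *)
Definition lambda_min (A : 'M[R]_d) : R := inf [set a : R | eigenvalue A a].

Definition partial (i : 'I_d) (g : 'rV[R]_d -> R) : 'rV[R]_d -> R :=
  fun z => 'D_(delta_mx 0 i) g z.

Definition grad (g : 'rV[R]_d -> R) (z : 'rV[R]_d) : 'rV[R]_d :=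
  \row_i partial i g z.

Definition hess (g : 'rV[R]_d -> R) (z : 'rV[R]_d) : 'M[R]_d :=
  \matrix_(i, j) partial i (partial j g) z.

Fixpoint class_C (k : nat) (g : 'rV[R]_d -> R) : Prop :=
  if k is k'.+1 then
    (forall z, differentiable g z) /\ (forall i, class_C k' (partial i g))
  else continuous g.

Definition strongly_concave (mu : R) (g : 'rV[R]_d -> R) : Prop :=
  forall (y1 y2 : 'rV[R]_d) (t : R), 0 <= t <= 1 ->
    t * g y1 + (1 - t) * g y2 + mu / 2 * t * (1 - t) * enorm (y1 - y2) ^+ 2
    <= g (t *: y1 + (1 - t) *: y2).

End Euclidean.

Section Minimax.
Variables (R : realType) (n m : nat).
Implicit Types (f : 'rV[R]_(n + m) -> R) (z xi : 'rV[R]_(n + m)).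

(* The maximum is attained when f(x, .) is strongly concave and continuous. *)
Definition Phi f (x : 'rV[R]_n) : R :=
  sup (range (fun y : 'rV[R]_m => f (row_mx x y))).

Definition Phi_bar f : R := inf (range (Phi f)).

Record standing (mu L rho : R) f : Prop := {
  standing_mu : 0 < mu;
  standing_L : 0 < L;
  standing_rho : 0 < rho;
  standing_C3 : class_C 3 f;
  standing_concave : forall x : 'rV[R]_n,
    strongly_concave mu (fun y : 'rV[R]_m => f (row_mx x y));
  standing_grad : forall z xi,
    enorm (grad f (z + xi) - grad f z) <= L * enorm xi;
  standing_hess : forall z xi,
    spectral_norm (hess f (z + xi) - hess f z) <= rho * enorm xi;
  (* Phi_bar f > -oo *)
  standing_Phi : has_lbound (range (Phi f))
}.

Definition grad_y f z : 'rV[R]_m := rsubmx (grad f z).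

Definition h_reg (beta : R) f z : R :=
  f z + beta / 2 * enorm (grad_y f z) ^+ 2.

Definition Pmx : 'M[R]_(n + m) := block_mx 0 0 0 1%:M.

Definition Hbar (beta : R) f z : 'M[R]_(n + m) :=
  hess f z + beta *: (hess f z *m Pmx *m hess f z).

Definition acqrn_model (beta alpha1 alpha2 : R) f z xi : R :=
  dot (grad (h_reg beta f) z) xi
  + dot (xi *m (Hbar beta f z + (alpha1 * enorm (grad_y f z))%:M)) xi / 2
  + alpha2 / 6 * enorm xi ^+ 3.

Definition acqrn (beta alpha1 alpha2 : R) f (z : nat -> 'rV[R]_(n + m)) : Prop :=
  forall k, exists xi : 'rV[R]_(n + m),
    (forall xi', acqrn_model beta alpha1 alpha2 f (z k) xi
                 <= acqrn_model beta alpha1 alpha2 f (z k) xi')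
    /\ z k.+1 = z k + xi.

Definition opt_measure (beta c : R) f z : R :=
  Num.max (Num.sqrt (enorm (grad (h_reg beta f) z) / c))
          (- (lambda_min (hess (h_reg beta f) z) / c)).

End Minimax.

(* min_{k = 1, ..., T} u k for T >= 1. *)
Definition min_upto (R : realType) (u : nat -> R) (T : nat) : R :=
  \big[Num.min/u 1%N]_(1 <= k < T.+1) u k.

(* Main.v *)
Require Import Defs.
From HB Require Import structures.
From mathcomp Require Import all_boot all_order all_algebra.
From mathcomp Require Import boolp classical_sets functions reals ereal topology.
From mathcomp Require Import normedtype sequences derive exp.
From mathcomp Require Import ring lra.

Set Implicit Arguments.
Unset Strict Implicit.
Unset Printing Implicit Defensive.

Import Order.TTheory GRing.Theory Num.Theory.
Import numFieldNormedType.Exports.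

Local Open Scope classical_set_scope.
Local Open Scope ring_scope.

(** Write [H] for the Hessian of [f], [P] for the projection on the [y]
  coordinates, [c = (3 beta L + 1) rho / 6], and [x k] for the length of the
  step from [z k] to [z k.+1].

  The subproblem minimizes a model whose quadratic part uses [Hbar], computable
  from second derivatives of [f] only.  The Hessian of [h = h_reg beta f] differs
  from [Hbar] by a third-derivative term paired with [grad_y f], so by at most
  [beta rho |grad_y f|].  Two Taylor estimates for [h] make this precise without
  third derivatives ([h_reg_upper] for values, [grad_h_reg_taylor] for
  gradients).  The first shows that the model overestimates [h] by at least
  [c |xi|^3]; since the model is [0] at [0], each step decreases [h] by at least
  [c (x k)^3] ([acqrn_descent]).  The conditions satisfied by a global minimizer
  of a cubic model ([cubic_min_stationary], [cubic_min_curvature]), combined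
  with the second estimate, bound the new gradient by
  [9 c (x k)^2 + 3 beta rho |grad_y f| x k] ([acqrn_grad_le]) and the negative
  curvature at the new point by [22 c x k] plus multiples of [|grad_y f|]
  ([acqrn_hess_ge]).

  Strong concavity and [beta > 1 / mu] enter twice.  They give
  [h >= Phi_bar + (beta - 1 / mu) / 2 |grad_y f|^2] ([Phi_bar_le]), so that [h]
  is bounded below and [|grad_y f|] is bounded along the iterates; and they give
  [(beta mu - 1) |grad_y f| <= |grad h|] ([grad_y_le]), so that the terms in
  [|grad_y f|] are eventually of higher order.

  What remains concerns real sequences.  The cubes of the step lengths are
  summable, which yields the limits.  For the rate, among the first [T] steps
  there are three consecutive ones of length [O((Delta0 / (c T))^(1/3))]
  ([dd_short_block]).  Three in a row are needed for a universal constant: the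
  first makes the gradient small, the second makes [|grad_y f|] of the order of
  the squared length, and after the third the terms in [|grad_y f|] are dominated
  by the others ([stationarity_window]).  For small [T] the a priori bound at
  the first iterate replaces this ([stationarity_first]). *)

(** * Euclidean and spectral norms *)

Section EuclideanSpace.
Context {R : realType} {d : nat}.
Implicit Types (u v w : 'rV[R]_d) (A B : 'M[R]_d) (a : R).

Lemma dotE u v : dot u v = \sum_i u 0 i * v 0 i.
Proof. by rewrite /dot mxE; apply: eq_bigr => i _; rewrite mxE. Qed.

Lemma dotC u v : dot u v = dot v u.
Proof. by rewrite !dotE; apply: eq_bigr => i _; rewrite mulrC. Qed.

Lemma dotDl u v w : dot (u + v) w = dot u w + dot v w.
Proof. by rewrite /dot mulmxDl mxE. Qed.

Lemma dotZl a u v : dot (a *: u) v = a * dot u v.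
Proof. by rewrite /dot -scalemxAl mxE. Qed.

Lemma dotDr u v w : dot w (u + v) = dot w u + dot w v.
Proof. by rewrite !(dotC w) dotDl. Qed.

Lemma dotZr a u v : dot v (a *: u) = a * dot v u.
Proof. by rewrite !(dotC v) dotZl. Qed.

Lemma dotNl u v : dot (- u) v = - dot u v.
Proof. by rewrite -scaleN1r dotZl mulN1r. Qed.

Lemma dotNr u v : dot v (- u) = - dot v u.
Proof. by rewrite !(dotC v) dotNl. Qed.

Lemma dot0l v : dot 0 v = 0.
Proof. by rewrite -(scale0r v) dotZl mul0r. Qed.

Lemma dot_mull u v A : dot (u *m A) v = dot u (v *m A^T).
Proof. by rewrite /dot trmx_mul trmxK mulmxA. Qed.

Lemma dot_ge0 u : 0 <= dot u u.
Proof. by rewrite dotE sumr_ge0// => i _; rewrite -expr2 sqr_ge0. Qed.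

Lemma dot_eq0 u : dot u u = 0 -> u = 0.
Proof.
rewrite dotE => /eqP; rewrite psumr_eq0 => [/allP u0|i _]; last first.
  by rewrite -expr2 sqr_ge0.
apply/rowP => i; rewrite mxE; apply/eqP.
by have := u0 i (mem_index_enum i); rewrite -expr2 sqrf_eq0.
Qed.

Lemma enorm_ge0 u : 0 <= enorm u.
Proof. exact: sqrtr_ge0. Qed.

Lemma enorm_sqr u : enorm u ^+ 2 = dot u u.
Proof. by rewrite sqr_sqrtr// dot_ge0. Qed.

Lemma enormZ a u : enorm (a *: u) = `|a| * enorm u.
Proof.
by rewrite /enorm dotZl dotZr mulrA -expr2 sqrtrM ?sqr_ge0// sqrtr_sqr.
Qed.

Lemma enormN u : enorm (- u) = enorm u.
Proof. by rewrite -scaleN1r enormZ normrN1 mul1r. Qed.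

Lemma enorm0 : enorm (0 : 'rV[R]_d) = 0.
Proof. by rewrite /enorm dot0l sqrtr0. Qed.

Lemma enorm_eq0 u : enorm u = 0 -> u = 0.
Proof. by move=> u0; apply: dot_eq0; rewrite -enorm_sqr u0 expr0n. Qed.

(** Expand the square of [|v| u - |u| v]. *)
Lemma dot_le u v : dot u v <= enorm u * enorm v.
Proof.
have [u0|u0] := eqVneq (enorm u) 0.
  by rewrite (enorm_eq0 u0) dot0l enorm0 mul0r.
have [v0|v0] := eqVneq (enorm v) 0.
  by rewrite (enorm_eq0 v0) dotC dot0l enorm0 mulr0.
have uv_gt0 : 0 < enorm u * enorm v.
  by rewrite mulr_gt0// lt_def enorm_ge0 ?u0 ?v0.
have := dot_ge0 (enorm v *: u - enorm u *: v).
rewrite !(dotDl, dotDr, dotNl, dotNr, dotZl, dotZr) (dotC v u) -!enorm_sqr => ge0.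
rewrite -(ler_pM2l uv_gt0); nra.
Qed.

Lemma ler_enormD u v : enorm (u + v) <= enorm u + enorm v.
Proof.
rewrite -(@ler_pXn2r _ 2) ?nnegrE ?addr_ge0 ?enorm_ge0//.
rewrite enorm_sqr !(dotDl, dotDr) (dotC v u) -!enorm_sqr.
have := dot_le u v; nra.
Qed.

Lemma ler_enormB u v : enorm (u - v) <= enorm u + enorm v.
Proof. by rewrite -(enormN v) ler_enormD. Qed.

Lemma normr_dot_le u v : `|dot u v| <= enorm u * enorm v.
Proof. by rewrite ler_norml dot_le lerNl -dotNl -(enormN u) dot_le. Qed.

(** Bounds a norm through linear functionals, which reduces vector-valued
  Taylor estimates to real-valued ones. *)
Lemma enorm_dual_le u a : 0 <= a -> (forall v, dot u v <= a * enorm v) -> enorm u <= a.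
Proof.
move=> a0 /(_ u); rewrite -enorm_sqr expr2.
have [->//|u0] := eqVneq (enorm u) 0.
by rewrite ler_pM2r// lt_def u0 enorm_ge0.
Qed.

Lemma coord_le_enorm u i : `|u 0 i| <= enorm u.
Proof.
rewrite -(@ler_pXn2r _ 2) ?nnegrE ?normr_ge0 ?enorm_ge0// enorm_sqr dotE.
rewrite real_normK ?num_real// (bigD1 i)//= -expr2 lerDl sumr_ge0// => j _.
by rewrite -expr2 sqr_ge0.
Qed.

Lemma normr_le_enorm u : `|u| <= enorm u.
Proof.
rewrite [leLHS]/Num.Def.normr/= mx_normrE; apply/bigmax_leP.
split=> [|[i j] _]; first exact: enorm_ge0.
by rewrite (ord1 i) coord_le_enorm.
Qed.

(** The supremum defining the spectral norm is over a bounded set, because the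
  Frobenius norm of [A] bounds it. *)
Lemma spectral_norm_has_sup A :
  has_sup [set enorm (v *m A^T) | v in [set v | enorm v <= 1]].
Proof.
split.
  by exists (enorm (0 *m A^T)); exists 0 => //=; rewrite enorm0 ler01.
exists (Num.sqrt (\sum_i enorm (row i A) ^+ 2)) => _ [v /= v1 <-].
rewrite ler_wsqrtr// dotE ler_sum// => i _.
have -> : (v *m A^T) 0 i = dot v (row i A).
  by rewrite dotE mxE; apply: eq_bigr => j _; rewrite !mxE.
rewrite -expr2 -real_normK ?num_real// ler_pXn2r ?nnegrE ?enorm_ge0//.
by rewrite (le_trans (normr_dot_le _ _))// ler_piMl// enorm_ge0.
Qed.

Lemma spectral_norm_ub A v : enorm (v *m A^T) <= spectral_norm A * enorm v.
Proof.
have [v0|v0] := eqVneq (enorm v) 0.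
  by rewrite (enorm_eq0 v0) mul0mx enorm0 mulr0.
have vgt0 : 0 < enorm v by rewrite lt_def v0 enorm_ge0.
rewrite -ler_pdivrMr// mulrC -[X in X * _]gtr0_norm ?invr_gt0// -enormZ.
rewrite scalemxAl; apply: sup_ubound; first by case: (spectral_norm_has_sup A).
by exists ((enorm v)^-1 *: v) => //=; rewrite enormZ gtr0_norm ?invr_gt0// mulVf.
Qed.

(** An eigenvector turns a lower bound on the quadratic form into a lower bound
  on its eigenvalue; [a >= 0] covers a matrix without real eigenvalues, for
  which the infimum is [0]. *)
Lemma lambda_min_ge A a : 0 <= a ->
  (forall v, - a * enorm v ^+ 2 <= dot (v *m A) v) -> - a <= lambda_min A.
Proof.
move=> a0 Aa; rewrite /lambda_min.
have [->|/set0P ne] := eqVneq [set b | eigenvalue A b] set0.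
  by rewrite inf0 oppr_le0.
apply: lb_le_inf => // b /= /eigenvalueP[v vA v0].
have := Aa v; rewrite vA dotZl -enorm_sqr ler_pM2r// exprn_gt0//.
by rewrite lt_def enorm_ge0 andbT; apply: contraNneq v0 => /enorm_eq0->.
Qed.

End EuclideanSpace.

(** * Calculus along lines *)

Section OneVariable.
Context {R : realType}.
Implicit Types (F : R -> R) (a b c t K : R).

(** Stands in for the passage to the limit [t -> 0] in difference quotients. *)
Lemma le_of_small a b K : (forall t, 0 < t -> t <= 1 -> a <= b + t * K) -> a <= b.
Proof.
move=> abK; rewrite leNgt; apply/negP => ba.
have K0 := normr_ge0 K; have KK := ler_norm K.
have e0 : 0 < a - b by rewrite subr_gt0.
pose D := 2 * (`|K| + (a - b)).
have D0 : 0 < D by rewrite /D; lra.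
have t0 : 0 < (a - b) / D by rewrite divr_gt0.
have tD : (a - b) / D * D = a - b by rewrite divfK// gt_eqF.
have t1 : (a - b) / D <= 1 by rewrite ler_pdivrMr// /D; lra.
have := abK _ t0 t1; move: tD t0; rewrite {2}/D.
set t := (a - b) / D => tD t0 le; nra.
Qed.

Lemma is_derive_continuous F (F' : R -> R) :
  (forall t, is_derive t 1 F (F' t)) -> continuous F.
Proof.
by move=> dF t; apply: differentiable_continuous; apply/derivable1_diffP.
Qed.

(** Comparison with the cubic that has the prescribed derivative bound: one
  mean value argument replaces integration of the remainder. *)
Lemma taylor_le F (F' : R -> R) a b c : (forall t, is_derive t 1 F (F' t)) ->
  (forall t, 0 <= t <= 1 -> F' t <= a + 2 * b * t + 3 * c * t ^+ 2) ->
  F 1 - F 0 <= a + b + c.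
Proof.
move=> dF F'le.
pose G t := F t - (a * t + b * t ^+ 2 + c * t ^+ 3).
have dG t : is_derive t 1 G (F' t - (a + 2 * b * t + 3 * c * t ^+ 2)).
  pose p : {poly R} := a *: 'X + b *: 'X^2 + c *: 'X^3.
  have -> : G = F \- horner p.
    by apply/funext => s; rewrite /G /p /= !hornerE.
  apply: is_derive_eq; rewrite /p !(derivD, derivZ, derivX, derivXn) !hornerE /=; ring.
have [] := @MVT_segment R G _ 0 1 ler01 (fun t _ => dG t).
  by apply: continuous_subspaceT; exact: is_derive_continuous dG.
move=> t; rewrite in_itv/= => t01.
have := F'le _ t01; rewrite /G; lra.
Qed.

Lemma mean_value_dist_le F (F' : R -> R) a b : (forall t, is_derive t 1 F (F' t)) ->
  (forall t, 0 <= t <= 1 -> `|F' t - a| <= b) -> `|F 1 - F 0 - a| <= b.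
Proof.
move=> dF F'ab; have [] := @MVT_segment R F _ 0 1 ler01 (fun t _ => dF t).
  by apply: continuous_subspaceT; exact: is_derive_continuous dF.
by move=> t; rewrite in_itv/= subr0 mulr1 => t01 ->; exact: F'ab.
Qed.

End OneVariable.

Section AlongLines.
Context {R : realType} {d : nat}.
Implicit Types (F f : 'rV[R]_d -> R) (z xi e : 'rV[R]_d) (t : R).

Lemma derive_grad F z xi : differentiable F z -> 'D_xi F z = dot (grad F z) xi.
Proof.
move=> dF; rewrite deriveE// {1}(row_sum_delta xi) linear_sum dotE.
by apply: eq_bigr => i _; rewrite linearZ /= mxE /partial deriveE// mulrC.
Qed.

Lemma is_derive_line F z xi t : differentiable F (z + t *: xi) ->
  is_derive t 1 (fun s => F (z + s *: xi)) (dot (grad F (z + t *: xi)) xi).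
Proof.
move=> dF.
have dl : is_diff t (fun s : R => z + s *: xi) ( *:%R^~ xi).
  have := is_diffD (is_diff_cst z t) (is_diff_scalel t xi).
  by rewrite add0r.
have dFl : differentiable (F \o (fun s : R => z + s *: xi)) t.
  by apply: differentiable_comp => //; case: dl.
have := derivableP (diff_derivable dFl : derivable _ _ (1 : R)).
rewrite deriveE// diff_comp//=.
by rewrite diff_val scale1r -deriveE// derive_grad.
Qed.

Lemma is_derive_grad_line f z xi e t :
  (forall j, differentiable (partial j f) (z + t *: xi)) ->
  is_derive t 1 (fun s => dot (grad f (z + s *: xi)) e)
    (dot (xi *m hess f (z + t *: xi)) e).
Proof.
move=> df.
have -> : (fun s => dot (grad f (z + s *: xi)) e) =
    \sum_j (fun s => e 0 j * partial j f (z + s *: xi)).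
  apply/funext => s; rewrite fct_sumE dotE.
  by apply: eq_bigr => j _; rewrite mxE mulrC.
have dj j : is_derive t 1 (fun s => e 0 j * partial j f (z + s *: xi))
    (e 0 j * dot (grad (partial j f) (z + t *: xi)) xi).
  have := is_derive_line (df j) => D.
  exact: is_deriveZ.
apply: is_derive_eq; rewrite dotE; apply: eq_bigr => j _.
rewrite mulrC dotE mxE; congr (_ * _); apply: eq_bigr => i _.
by rewrite !mxE mulrC.
Qed.

End AlongLines.

(** * Taylor estimates under a Lipschitz Hessian *)

Section LipschitzHessian.
Context {R : realType} {d : nat} (f : 'rV[R]_d -> R) (L rho : R).
Hypothesis rho_ge0 : 0 <= rho.
Hypothesis df : forall z : 'rV[R]_d, differentiable f z.
Hypothesis ddf : forall j (z : 'rV[R]_d), differentiable (partial j f) z.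
Hypothesis grad_lip : forall z xi : 'rV[R]_d,
  enorm (grad f (z + xi) - grad f z) <= L * enorm xi.
Hypothesis hess_lip : forall z xi : 'rV[R]_d,
  spectral_norm (hess f (z + xi) - hess f z) <= rho * enorm xi.
Implicit Types (z xi u v e : 'rV[R]_d).

Lemma grad_taylor z xi :
  enorm (grad f (z + xi) - grad f z - xi *m hess f z) <= rho / 2 * enorm xi ^+ 2.
Proof.
apply: enorm_dual_le => [|e]; first by rewrite mulr_ge0 ?divr_ge0 ?exprn_ge0 ?enorm_ge0.
pose F (t : R) := dot (grad f (z + t *: xi)) e.
pose b := rho / 2 * enorm xi ^+ 2 * enorm e.
have := @taylor_le R F _ (dot (xi *m hess f z) e) b 0
  (fun t => is_derive_grad_line e (fun j => ddf j (z + t *: xi))).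
rewrite /F scale1r scale0r !addr0 !(dotDl, dotNl) => le.
suff: dot (grad f (z + xi)) e - dot (grad f z) e
    <= dot (xi *m hess f z) e + b by rewrite /b; lra.
apply: le => t /andP[t0 t1]; rewrite mulr0 mul0r addr0 -lerBlDl.
rewrite -dotNl -dotDl -mulmxN -mulmxDr dot_mull.
apply: (le_trans (dot_le _ _)).
apply: (@le_trans _ _ (enorm xi * (rho * enorm (t *: xi) * enorm e))).
  apply: ler_wpM2l; first exact: enorm_ge0.
  apply: (le_trans (spectral_norm_ub _ _)).
  by apply: ler_wpM2r; [exact: enorm_ge0 | exact: hess_lip].
by rewrite enormZ ger0_norm// /b le_eqVlt; apply/orP; left; apply/eqP; field.
Qed.

Lemma function_taylor z xi :
  f (z + xi) <= f z + dot (grad f z) xi + dot (xi *m hess f z) xi / 2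
    + rho / 6 * enorm xi ^+ 3.
Proof.
pose F (t : R) := f (z + t *: xi).
have := @taylor_le R F _ (dot (grad f z) xi) (dot (xi *m hess f z) xi / 2)
  (rho / 6 * enorm xi ^+ 3) (fun t => is_derive_line (df (z + t *: xi))).
rewrite /F scale1r scale0r !addr0 => le.
suff: f (z + xi) - f z <= dot (grad f z) xi + dot (xi *m hess f z) xi / 2
  + rho / 6 * enorm xi ^+ 3 by lra.
apply: le => t /andP[t0 t1].
have := dot_le (grad f (z + t *: xi) - grad f z - t *: xi *m hess f z) xi.
rewrite !(dotDl, dotNl) -scalemxAl dotZl => le.
have := ler_wpM2r (enorm_ge0 xi) (grad_taylor z (t *: xi)).
rewrite enormZ ger0_norm// -scalemxAl => /(le_trans le).
rewrite exprMn (_ : rho / 2 * (t ^+ 2 * enorm xi ^+ 2) * enorm xi =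
  3 * (rho / 6 * enorm xi ^+ 3) * t ^+ 2); first by lra.
by field.
Qed.

(** The mixed second difference of [f] along [t u] and [t v] is symmetric in
  [u] and [v]; to leading order it is [t^2] times either side of the symmetry
  relation, by the mean value theorem in the direction [u]. *)
Lemma second_difference z u v : exists K, forall t : R, 0 < t -> t <= 1 ->
  `|f (z + t *: v + t *: u) - f (z + t *: u) - f (z + t *: v) + f z
    - t ^+ 2 * dot (v *m hess f z) u| <= t ^+ 2 * (t * K).
Proof.
pose M := enorm u + enorm v; exists (rho * M ^+ 2 * enorm u) => t t0 t1.
have M0 : 0 <= M by rewrite addr_ge0 ?enorm_ge0.
pose F (s : R) := f (z + t *: v + s *: (t *: u)) - f (z + s *: (t *: u)).
pose F' (s : R) := dot (grad f (z + t *: v + s *: (t *: u))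
  - grad f (z + s *: (t *: u))) (t *: u).
have dF (s : R) : is_derive s 1 F (F' s).
  have D1 := is_derive_line (df (z + t *: v + s *: (t *: u))).
  have D2 := is_derive_line (df (z + s *: (t *: u))).
  by apply: is_derive_eq; rewrite /F' dotDl dotNl.
have := @mean_value_dist_le R F F' (t ^+ 2 * dot (v *m hess f z) u)
  (t ^+ 2 * (t * (rho * M ^+ 2 * enorm u))) dF.
rewrite /F !scale1r !scale0r !addr0.
set X := `|_|; set Y := `|_|; have -> : X = Y by congr (`|_|); ring.
apply=> s /andP[s0 s1].
have E1 := grad_taylor z (t *: v + s *: (t *: u)).
have E2 := grad_taylor z (s *: (t *: u)).
set g1 := grad f _ - _ - _ in E1; set g2 := grad f _ - _ - _ in E2.
have -> : F' s - t ^+ 2 * dot (v *m hess f z) u = dot (g1 - g2) (t *: u).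
  rewrite /F' /g1 /g2 addrA mulmxDl !(dotDl, dotNl, dotZl, dotZr, =^~ scalemxAl).
  ring.
apply: (le_trans (normr_dot_le _ _)).
have N1 : enorm (t *: v + s *: (t *: u)) <= t * M.
  apply: (le_trans (ler_enormD _ _)).
  rewrite !enormZ (ger0_norm s0) (gtr0_norm t0) /M.
  have := ler_piMl (mulr_ge0 (ltW t0) (enorm_ge0 u)) s1; lra.
have N2 : enorm (s *: (t *: u)) <= t * M.
  rewrite !enormZ (ger0_norm s0) (gtr0_norm t0) /M.
  have := mulr_ge0 (ltW t0) (enorm_ge0 v).
  by have := ler_piMl (mulr_ge0 (ltW t0) (enorm_ge0 u)) s1; lra.
have sq (x : R) : 0 <= x -> x <= t * M -> rho / 2 * x ^+ 2 <= rho / 2 * (t * M) ^+ 2.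
  move=> x0 xM; rewrite ler_wpM2l ?divr_ge0// ler_pXn2r// nnegrE//.
  by rewrite mulr_ge0// ltW.
have := sq _ (enorm_ge0 _) N1; have := sq _ (enorm_ge0 _) N2.
move=> /(le_trans E2) {}E2 /(le_trans E1) {}E1.
rewrite enormZ gtr0_norm// (_ : t ^+ 2 * _ = rho * (t * M) ^+ 2 * (t * enorm u)); last by ring.
apply: ler_wpM2r; first by rewrite mulr_ge0 ?enorm_ge0// ltW.
apply: (le_trans (ler_enormB _ _)); apply: (le_trans (lerD E1 E2)).
by rewrite le_eqVlt; apply/orP; left; apply/eqP; field.
Qed.

(** Schwarz's theorem, read off the symmetric second difference. *)
Lemma hess_dot_sym z u v : dot (v *m hess f z) u = dot (u *m hess f z) v.
Proof.
wlog suff le : u v / dot (v *m hess f z) u <= dot (u *m hess f z) v.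
  by apply/eqP; rewrite eq_le !le.
have [K1 uv] := second_difference z u v; have [K2 vu] := second_difference z v u.
apply: (@le_of_small _ _ _ (K1 + K2)) => t t0 t1.
have t2 : 0 < t ^+ 2 by rewrite exprn_gt0.
rewrite -(ler_pM2l t2).
have := uv t t0 t1; have := vu t t0 t1.
rewrite !ler_norml [z + t *: u + t *: v]addrAC => /andP[_ +] /andP[+ _].
by lra.
Qed.

Lemma hess_sym z : (hess f z)^T = hess f z.
Proof.
apply/matrixP => i j; rewrite mxE.
have E a b : hess f z a b = dot (delta_mx 0 a *m hess f z) (delta_mx 0 b).
  rewrite -rowE dotE (bigD1 b)//= !mxE !eqxx mulr1 big1 ?addr0// => k /negPf kb.
  by rewrite !mxE kb mulr0.
by rewrite !E hess_dot_sym.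
Qed.

(** The Hessian is the limit of difference quotients of the gradient, with a
  remainder controlled by [grad_taylor]. *)
Lemma enorm_hess_le z v : enorm (v *m hess f z) <= L * enorm v.
Proof.
apply: (@le_of_small _ _ _ (rho / 2 * enorm v ^+ 2)) => t t0 t1.
rewrite -(ler_pM2l t0).
have := ler_enormB (grad f (z + t *: v) - grad f z)
  (grad f (z + t *: v) - grad f z - t *: v *m hess f z).
rewrite opprB addrCA subrr addr0 -scalemxAl.
have := grad_lip z (t *: v); have := grad_taylor z (t *: v).
by rewrite -scalemxAl !enormZ gtr0_norm// exprMn; lra.
Qed.

Lemma enorm_hess_diff_le z xi v :
  enorm (v *m (hess f (z + xi) - hess f z)) <= rho * enorm xi * enorm v.
Proof.
have -> : hess f (z + xi) - hess f z = (hess f (z + xi) - hess f z)^T.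
  move: (hess_sym (z + xi)) (hess_sym z).
  by move: (hess f (z + xi)) (hess f z) => A' A A'_sym A_sym; rewrite linearB /= A'_sym A_sym.
apply: (le_trans (spectral_norm_ub _ _)).
by rewrite ler_wpM2r ?enorm_ge0.
Qed.

End LipschitzHessian.

(** * The regularized function *)

Section YProjection.
Context {R : realType} {n m : nat}.
Implicit Types (u v w : 'rV[R]_(n + m)).
Local Notation P := (Pmx R n m).

Lemma mulmx_Pmx v : v *m P = row_mx 0 (rsubmx v).
Proof.
by rewrite -{1}[v]hsubmxK mul_row_block !mulmx0 mulmx1 addr0 add0r.
Qed.

Lemma Pmx_sym : P^T = P.
Proof. by rewrite /Pmx tr_block_mx !trmx0 trmx1. Qed.

Lemma Pmx_idem : P *m P = P.
Proof. by rewrite /Pmx mulmx_block !(mulmx0, mul0mx, mulmx1, addr0, add0r). Qed.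

Lemma dot_Pmxl u v : dot (u *m P) v = dot u (v *m P).
Proof. by rewrite dot_mull Pmx_sym. Qed.

Lemma dot_Pmx u v : dot (u *m P) (v *m P) = dot (u *m P) v.
Proof. by rewrite -dot_Pmxl -mulmxA Pmx_idem. Qed.

Lemma enorm_Pmx_le v : enorm (v *m P) <= enorm v.
Proof.
apply: enorm_dual_le => [|w]; first exact: enorm_ge0.
have [w0|w0] := eqVneq (enorm (w *m P)) 0.
  by rewrite dot_Pmxl (enorm_eq0 w0) dotC dot0l mulr_ge0 ?enorm_ge0.
rewrite dot_Pmxl (le_trans (dot_le _ _))// ler_wpM2l ?enorm_ge0//.
have := dot_le (w *m P) w; rewrite -dot_Pmx -enorm_sqr expr2 ler_pM2l//.
by rewrite lt_def w0 enorm_ge0.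
Qed.

Lemma enorm_row_mx0 (y : 'rV[R]_m) : enorm (row_mx (0 : 'rV[R]_n) y) = enorm y.
Proof. by rewrite /enorm /dot tr_row_mx mul_row_col mul0mx add0r. Qed.

Lemma enorm_grad_y f (z : 'rV[R]_(n + m)) :
  enorm (grad_y f z) = enorm (grad f z *m P).
Proof. by rewrite mulmx_Pmx enorm_row_mx0. Qed.

End YProjection.

(** An affine approximation of [F] at [0] that is exact up to an error [b] per
  unit of [t] locates the derivative up to [b]; this reads second derivatives
  off first-order expansions of a gradient. *)
Lemma derive0_dist_le {R : realType} (F : R -> R) (D a b K : R) :
  is_derive (0 : R) 1 F D ->
  (forall t : R, `|F t - F 0 - t * a| <= `|t| * (b + `|t| * K)) -> `|D - a| <= b.
Proof.
move=> dF Fab; apply: (@le_of_small _ _ _ (1 + `|K|)) => e e0 _.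
have lim : (fun h : R => h^-1 *: (F (h *: 1 + 0) - F 0)) @ 0^' --> D.
  have -> : D = 'D_1 F 0 by rewrite derive_val.
  by have := @ex_derive _ _ _ _ _ _ _ dF.
have near1 : \forall t \near (0 : R)^', `|t| < e by exact: dnbhs0_lt.
have near2 : \forall t \near (0 : R)^', t != 0 :> R by exact: nbhs_dnbhs_neq.
have near3 : \forall t \near (0 : R)^', `|D - t^-1 *: (F (t *: 1 + 0) - F 0)| < e.
  by move: lim => /cvgrPdist_lt; exact.
have [t [[te t0] De]] := filter_ex (filterI (filterI near1 near2) near3).
move: De => /=; rewrite addr0 [t *: 1]mulr1 => De.
have nt : 0 < `|t| by rewrite normr_gt0.
have : `|t^-1 * (F t - F 0) - a| <= b + `|t| * K.
  rewrite -(ler_pM2l nt) -normrM mulrBr mulrA divff// mul1r.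
  exact: Fab.
move=> Fa; rewrite -(subrKA (t^-1 * (F t - F 0))).
apply: (le_trans (ler_normD _ _)); apply: (le_trans (lerD (ltW De) Fa)).
have KK := ler_norm K; have K0 := normr_ge0 K.
have := ler_wpM2l (normr_ge0 t) KK; have := ler_wpM2r K0 (ltW te).
by rewrite mulrDr mulr1; lra.
Qed.

Section Regularized.
Context {R : realType} {n m : nat} (f : 'rV[R]_(n + m) -> R) (mu L rho beta : R).
Hypothesis std : standing mu L rho f.
Hypothesis beta_gt : mu^-1 < beta.
Local Notation P := (Pmx R n m).
Local Notation h := (h_reg beta f).
Local Notation c := ((3 * beta * L + 1) * rho / 6).
Implicit Types (z xi u v e : 'rV[R]_(n + m)).

Let mu_gt0 : 0 < mu. Proof. by case: std. Qed.
Let L_gt0 : 0 < L. Proof. by case: std. Qed.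
Let rho_gt0 : 0 < rho. Proof. by case: std. Qed.
Let beta_gt0 : 0 < beta.
Proof. by rewrite (lt_trans _ beta_gt)// invr_gt0. Qed.

Let df : forall z, differentiable f z.
Proof. by case: std => _ _ _ [? _]. Qed.

Let ddf : forall j z, differentiable (partial j f) z.
Proof. by case: std => _ _ _ [_ +] _ _ _ _ j z => /(_ j)[]. Qed.

Let dddf : forall i j z, differentiable (partial i (partial j f)) z.
Proof. by case: std => _ _ _ [_ +] _ _ _ _ i j z => /(_ j)[_ /(_ i)[]]. Qed.

Let gtaylor z xi : enorm (grad f (z + xi) - grad f z - xi *m hess f z)
  <= rho / 2 * enorm xi ^+ 2.
Proof. by case: std => *; exact: grad_taylor (ltW rho_gt0) _ _ _ _. Qed.

Let grad_lip z xi : enorm (grad f (z + xi) - grad f z) <= L * enorm xi.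
Proof. by case: std => *. Qed.

Let hsym z : (hess f z)^T = hess f z.
Proof. by case: std => *; exact: hess_sym (ltW rho_gt0) _ _ _ _. Qed.

Let hle z v : enorm (v *m hess f z) <= L * enorm v.
Proof. by case: std => *; exact: enorm_hess_le (ltW rho_gt0) _ _ _ _ _. Qed.

Let hdiff z xi v :
  enorm (v *m (hess f (z + xi) - hess f z)) <= rho * enorm xi * enorm v.
Proof. by case: std => *; exact: enorm_hess_diff_le (ltW rho_gt0) _ _ _ _ _ _. Qed.

Let ftaylor z xi :
  f (z + xi) <= f z + dot (grad f z) xi + dot (xi *m hess f z) xi / 2
    + rho / 6 * enorm xi ^+ 3.
Proof. by case: std => *; exact: function_taylor (ltW rho_gt0) _ _ _ _ _. Qed.

Lemma Hbar_sym z : (Hbar beta f z)^T = Hbar beta f z.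
Proof. by rewrite /Hbar linearD /= linearZ /= !trmx_mul Pmx_sym hsym mulmxA. Qed.

Lemma h_regE : h = f + (beta / 2) *: (\sum_(l < m) partial (rshift n l) f ^+ 2).
Proof.
apply/funext => z; rewrite /h_reg enorm_sqr dotE.
rewrite [in RHS]/GRing.add/= [in RHS]/GRing.scale/= fct_sumE.
by congr (_ + _ * _); apply: eq_bigr => l _; rewrite !mxE expr2.
Qed.

Lemma partial_h_reg j : partial j h = partial j f +
  beta *: (\sum_(l < m) partial (rshift n l) f * partial j (partial (rshift n l) f)).
Proof.
apply/funext => z.
have D0 : is_derive z (delta_mx 0 j) f (partial j f z).
  exact: derivableP (diff_derivable (df z)).
have Dl (l : 'I_m) : is_derive z (delta_mx 0 j) (partial (rshift n l) f)
    (partial j (partial (rshift n l) f) z).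
  exact: derivableP (diff_derivable (ddf (rshift n l) z)).
have D : is_derive z (delta_mx 0 j)
    (f + (beta / 2) *: (\sum_(l < m) partial (rshift n l) f ^+ 2)) _ :=
  is_deriveD D0 (is_deriveZ (beta / 2) (is_derive_sum (fun l => is_deriveX 2 (Dl l)))).
have -> : partial j h z = partial j f z +
    (beta / 2) *: \sum_(l < m) (2 *: partial (rshift n l) f z ^+ 1)
      *: partial j (partial (rshift n l) f) z.
  by rewrite {1}/partial h_regE; exact: (@derive_val _ _ _ _ _ _ _ D).
rewrite [in RHS]/GRing.add/= [in RHS]/GRing.scale/= fct_sumE.
congr (_ + _); rewrite !scaler_sumr; apply: eq_bigr => l _.
rewrite [in RHS]/GRing.mul/= /GRing.scale/= expr1.
set a := partial _ _ _; by set b := partial _ _ _; field.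
Qed.

Lemma differentiable_partial_h_reg j z : differentiable (partial j h) z.
Proof.
rewrite partial_h_reg; apply: differentiableD => //.
apply: differentiableZ; apply: differentiable_sum => l.
exact: differentiableM.
Qed.

Lemma grad_h_reg z :
  grad h z = grad f z + beta *: (grad f z *m P *m hess f z).
Proof.
rewrite -[hess f z]hsym; apply/rowP => j; rewrite !mxE partial_h_reg.
rewrite [in LHS]/GRing.add/= [in LHS]/GRing.scale/= fct_sumE.
congr (_ + _ * _); rewrite mulmx_Pmx big_split_ord/= [X in _ = X + _]big1 ?add0r => [|i _].
  by apply: eq_bigr => l _; rewrite row_mxEr !mxE.
by rewrite row_mxEl mxE mul0r.
Qed.

Lemma cubic_coeff_gt0 : 0 < c.
Proof.
by rewrite divr_gt0// mulr_gt0// addr_gt0// !mulr_gt0.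
Qed.

(** The nonlinear part of [grad_y f (z + xi)], of size [rho / 2 |xi|^2], enters the
  square in [h_reg] multiplied by [grad_y f z], which gives the first correction
  to the quadratic expansion, and by increments of size [L |xi|], which
  contribute to the cubic one. *)
Lemma h_reg_upper z xi :
  h (z + xi) <= h z + dot (grad h z) xi + dot (xi *m Hbar beta f z) xi / 2
    + beta * rho / 2 * enorm (grad_y f z) * enorm xi ^+ 2 + c * enorm xi ^+ 3.
Proof.
rewrite /h_reg !enorm_grad_y grad_h_reg /Hbar.
have ft := ftaylor z xi.
set g := grad f z in ft *; set G := grad f (z + xi).
pose a := g *m P; pose b := xi *m hess f z *m P.
pose e := (G - g - xi *m hess f z) *m P.
have GP : G *m P = a + b + e.
  rewrite /a /b /e -!mulmxDl; congr (_ *m _).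
  by rewrite -addrA [X in _ = _ + X]addrC subrK addrC subrK.
have x0 := enorm_ge0 xi; have a0 := enorm_ge0 a.
have eN : enorm e <= rho / 2 * enorm xi ^+ 2 := le_trans (enorm_Pmx_le _) (gtaylor z xi).
have bN : enorm b <= L * enorm xi := le_trans (enorm_Pmx_le _) (hle z xi).
have GaN : enorm (b + e) <= L * enorm xi.
  have -> : b + e = (G - g) *m P.
    by rewrite mulmxBl GP -/a -[X in X - _]addrA [RHS]addrAC subrr add0r.
  by rewrite (le_trans (enorm_Pmx_le _))// grad_lip.
have E1 : dot (a *m hess f z) xi = dot a b.
  by rewrite dot_mull hsym /a /b dot_Pmx dot_Pmxl.
have E2 : dot (xi *m (hess f z *m P *m hess f z)) xi = dot b b.
  by rewrite !mulmxA -/b dot_mull hsym /b dot_Pmx dot_Pmxl.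
rewrite dotDl dotZl -/a E1 mulmxDr dotDl -scalemxAr dotZl E2 GP.
move: (f _) (f z) (dot g xi) (dot (xi *m hess f z) xi) ft => fz' fz gx xHx ft.
move: a b e (enorm xi) eN bN GaN x0 a0 ft {GP E1 E2} => a b e x eN bN GaN x0 a0 ft.
have SN : enorm (2 *: a + b + (b + e)) <= 2 * enorm a + 2 * (L * x).
  have := ler_enormD (2 *: a + b) (b + e); have := ler_enormD (2 *: a) b.
  by rewrite enormZ gtr0_norm//; lra.
have eS : dot e (2 *: a + b + (b + e))
    <= rho / 2 * x ^+ 2 * (2 * enorm a + 2 * (L * x)).
  apply: (le_trans (dot_le _ _)); apply: ler_pM => //; exact: enorm_ge0.
(* [a + b] is the linearization of [grad_y f (z + xi)] and [e] its error; the
   factor [2 a + b + (b + e)] sums linearization and exact value. *)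
have sq : enorm (a + b + e) ^+ 2 = enorm a ^+ 2 + 2 * dot a b + dot b b
    + dot e (2 *: a + b + (b + e)).
  rewrite !enorm_sqr !(dotDl, dotDr, dotZr) (dotC b a) (dotC b e) (dotC a e); ring.
have := ler_wpM2l (ltW beta_gt0) eS; rewrite sq.
rewrite (_ : rho / 2 * x ^+ 2 * _ = rho * x ^+ 2 * enorm a
  + rho * L * x ^+ 3); last by field.
move: (enorm a) (dot a b) (dot b b) (dot e _) ft => na ab bb ee ft.
lra.
Qed.

(** The error splits into the Taylor remainder [r] of [grad f], the variation of
  the Hessian applied to [grad_y f (z + xi)], and [r] sent through [P] and [H];
  the middle part produces the term in [|grad_y f z|]. *)
Lemma grad_h_reg_taylor z xi :
  enorm (grad h (z + xi) - grad h z - xi *m Hbar beta f z)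
  <= 3 * c * enorm xi ^+ 2 + beta * rho * enorm (grad_y f z) * enorm xi.
Proof.
rewrite enorm_grad_y !grad_h_reg /Hbar.
pose r := grad f (z + xi) - grad f z - xi *m hess f z.
have b0 := ltW beta_gt0; have r0 := ltW rho_gt0; have L0 := ltW L_gt0.
have x0 := enorm_ge0 xi.
have rN : enorm r <= rho / 2 * enorm xi ^+ 2 := gtaylor z xi.
have GN : enorm (grad f (z + xi) *m P) <= enorm (grad f z *m P) + L * enorm xi.
  rewrite -[grad f (z + xi)](subrK (grad f z)) addrC mulmxDl.
  apply: (le_trans (ler_enormD _ _)); rewrite lerD2l.
  by rewrite (le_trans (enorm_Pmx_le _))// grad_lip.
have H1 := le_trans (hdiff z xi (grad f (z + xi) *m P)) (ler_wpM2l (mulr_ge0 r0 x0) GN).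
have H2 : enorm (r *m P *m hess f z) <= L * (rho / 2 * enorm xi ^+ 2).
  apply: (le_trans (hle _ _)); apply: ler_wpM2l => //.
  exact: le_trans (enorm_Pmx_le _) rN.
have H3 := ler_wpM2l b0 (le_trans (ler_enormD _ _) (lerD H1 H2)).
have -> : grad f (z + xi) + beta *: (grad f (z + xi) *m P *m hess f (z + xi))
    - (grad f z + beta *: (grad f z *m P *m hess f z))
    - xi *m (hess f z + beta *: (hess f z *m P *m hess f z))
  = r + beta *: (grad f (z + xi) *m P *m (hess f (z + xi) - hess f z)
      + r *m P *m hess f z).
  rewrite /r; move: (grad f (z + xi)) (grad f z) (hess f z) (hess f (z + xi)).
  move=> g' g A A'; rewrite !mulmxBl !mulmxBr mulmxDr -scalemxAr !mulmxA.
  move: (g' *m P *m A') (g *m P *m A) (xi *m A *m P *m A) (g' *m P *m A) (xi *m A).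
  move=> v1 v2 v3 v4 v5; apply/rowP => j; rewrite !mxE; ring.
apply: (le_trans (ler_enormD _ _)); apply: (le_trans (lerD rN (lexx _))).
rewrite enormZ (ger0_norm b0) -lerBrDl; apply: (le_trans H3).
move: (enorm xi) (enorm _) => x y.
by rewrite le_eqVlt; apply/orP; left; apply/eqP; field.
Qed.

(** The Hessian of [h_reg] contains third derivatives of [f].  Instead of bounding
  these, pass to the limit in [grad_h_reg_taylor] along [z + t v]. *)
Lemma hess_h_reg_dist z v :
  `|dot (v *m hess h z) v - dot (v *m Hbar beta f z) v|
  <= beta * rho * enorm (grad_y f z) * enorm v ^+ 2.
Proof.
pose F (t : R) := dot (grad h (z + t *: v)) v.
have dF : is_derive (0 : R) 1 F (dot (v *m hess h z) v).
  have := @is_derive_grad_line _ _ h z v v 0.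
  by rewrite scale0r addr0; apply => j; exact: differentiable_partial_h_reg.
apply: (derive0_dist_le (K := 3 * c * enorm v ^+ 3) dF) => t.
rewrite /F scale0r addr0.
have := normr_dot_le (grad h (z + t *: v) - grad h z - t *: v *m Hbar beta f z) v.
rewrite !(dotDl, dotNl) -scalemxAl dotZl => /le_trans; apply.
have := ler_wpM2r (enorm_ge0 v) (grad_h_reg_taylor z (t *: v)).
rewrite -scalemxAl enormZ => /le_trans; apply.
move: (enorm v) (enorm _) `|t| => x y s.
by rewrite le_eqVlt; apply/orP; left; apply/eqP; field.
Qed.

(** The quadratic form of [Hbar] is [v H v + beta |v H P|^2]; the two parts drop
  by at most [rho |xi| |v|^2] and [2 beta L rho |xi| |v|^2], whose sum is at most
  [6 c |xi| |v|^2]. *)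
Lemma dot_Hbar_lip z xi v :
  dot (v *m Hbar beta f z) v - 6 * c * enorm xi * enorm v ^+ 2
  <= dot (v *m Hbar beta f (z + xi)) v.
Proof.
have E w : dot (v *m Hbar beta f w) v
    = dot (v *m hess f w) v + beta * enorm (v *m hess f w *m P) ^+ 2.
  rewrite /Hbar mulmxDr dotDl -scalemxAr dotZl !mulmxA; congr (_ + _ * _).
  by rewrite dot_mull hsym enorm_sqr dot_Pmx.
rewrite [X in _ <= X]E [X in X - _]E.
have H1 := normr_dot_le (v *m (hess f (z + xi) - hess f z)) v.
have H2 := hdiff z xi v.
have H3 : enorm (v *m hess f z *m P) <= L * enorm v.
  exact: le_trans (enorm_Pmx_le _) (hle _ _).
move: (hess f (z + xi)) (hess f z) H1 H2 H3 => A' A H1 H2 H3.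
rewrite mulmxBr in H1 H2.
have H4 : enorm (v *m A *m P) <= enorm (v *m A' *m P) + rho * enorm xi * enorm v.
  have -> : v *m A *m P = v *m A' *m P - (v *m A' - v *m A) *m P.
    by rewrite mulmxBl opprB addrCA subrr addr0.
  apply: (le_trans (ler_enormB _ _)); rewrite lerD2l.
  exact: le_trans (enorm_Pmx_le _) H2.
have v0 := enorm_ge0 v; have x0 := enorm_ge0 xi.
have p0 := enorm_ge0 (v *m A *m P).
have q0 := enorm_ge0 (v *m A' *m P).
have H5 := ler_wpM2r v0 H2.
move: H1; rewrite dotDl dotNl ler_norml => /andP[H1 _].
move: (dot _ v) (dot _ v) (enorm (v *m A *m P))
  (enorm (v *m A' *m P)) (enorm v) (enorm xi) (enorm _) H1 H2 H3 H4 H5 v0 x0 p0 q0.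
move=> D D' p q nv x w H1 H2 H3 H4 H5 v0 x0 p0 q0.
have pq : p ^+ 2 - 2 * L * (rho * x * nv * nv) <= q ^+ 2.
  have y0 : 0 <= rho * x * nv by rewrite !mulr_ge0 ?(ltW L_gt0) ?(ltW rho_gt0).
  have Ly : p * (rho * x * nv) <= L * nv * (rho * x * nv) by rewrite ler_wpM2r.
  have [pq|qp] := leP p q.
    have : p ^+ 2 <= q ^+ 2 by rewrite ler_pXn2r ?nnegrE.
    have : 0 <= L * (rho * x * nv * nv) by rewrite !mulr_ge0 ?(ltW L_gt0) ?(ltW rho_gt0).
    lra.
  have : p * p <= p * (q + rho * x * nv) by rewrite ler_wpM2l.
  have : q * p <= q * (q + rho * x * nv) by rewrite ler_wpM2l.
  have : q * (rho * x * nv) <= p * (rho * x * nv) by rewrite ler_wpM2r// ltW.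
  lra.
have := ler_wpM2l (ltW beta_gt0) pq.
have : 0 <= beta * L * rho * x * nv ^+ 2.
  by rewrite !mulr_ge0 ?exprn_ge0 ?(ltW beta_gt0) ?(ltW L_gt0) ?(ltW rho_gt0).
rewrite expr2; lra.
Qed.

(** Strong concavity in [y] at infinitesimal steps: in the [y] directions [f]
  lies below its tangent by the strong-concavity gap. *)
Lemma concave_tangent z e : e *m P = e ->
  f (z + e) <= f z + dot (grad f z) e - mu / 2 * enorm e ^+ 2.
Proof.
rewrite mulmx_Pmx => eE; have [_ _ _ _ /(_ (lsubmx z)) cc _ _ _] := std.
have fz (t : R) : f (row_mx (lsubmx z) (rsubmx z + t *: rsubmx e)) = f (z + t *: e).
  by rewrite -{3}[z]hsubmxK -{2}eE scale_row_mx scaler0 add_row_mx addr0.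
apply: (@le_of_small _ _ _ (dot (e *m hess f z) e / 2 + rho / 6 * enorm e ^+ 3
  + mu / 2 * enorm e ^+ 2)) => t t0 t1.
have t01 : 0 <= t <= 1 by rewrite ltW.
have := cc (rsubmx z + rsubmx e) (rsubmx z) t t01.
have -> : t *: (rsubmx z + rsubmx e) + (1 - t) *: rsubmx z = rsubmx z + t *: rsubmx e.
  by rewrite scalerDr scalerBl scale1r addrAC addrCA subrr addr0.
have -> : rsubmx z + rsubmx e - rsubmx z = rsubmx e by rewrite addrC addKr.
rewrite fz; have := fz 1; rewrite !scale1r => ->; rewrite hsubmxK.
rewrite -(enorm_row_mx0 (n := n) (rsubmx e)) eE => /le_trans /(_ (ftaylor z (t *: e))).
rewrite enormZ gtr0_norm// -scalemxAl !(dotZl, dotZr) exprMn => H.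
rewrite -(ler_pM2l t0).
have : t ^+ 3 * (rho / 6 * enorm e ^+ 3) <= t ^+ 2 * (rho / 6 * enorm e ^+ 3).
  rewrite ler_wpM2r ?mulr_ge0 ?exprn_ge0 ?enorm_ge0 ?divr_ge0 ?(ltW rho_gt0)//.
  by rewrite exprS ler_piMl// exprn_ge0// ltW.
move: (f _) (f z) (dot _ e) (dot _ e) (enorm e) H => a b p q x H.
lra.
Qed.

(** Maximize the concave upper bound of [concave_tangent] over [|e|]. *)
Lemma f_le_grad_y z e : e *m P = e ->
  f (z + e) <= f z + enorm (grad_y f z) ^+ 2 / (2 * mu).
Proof.
move=> eP; apply: (le_trans (concave_tangent z eP)); rewrite enorm_grad_y.
rewrite -{1}eP -dot_Pmxl; have := dot_le (grad f z *m P) e.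
move: (f z) (dot _ e) (enorm _) (enorm e) => a p g x le.
have := sqr_ge0 (g - mu * x) => sq.
rewrite -addrA lerD2l ler_pdivlMr ?mulr_gt0//.
have := ler_wpM2r (ltW mu_gt0) le; nra.
Qed.

(** By [f_le_grad_y] the gap between [f z] and its maximum over [y] is at most
  [|grad_y f|^2 / (2 mu)], whereas [h_reg] adds [beta / 2 |grad_y f|^2]. *)
Lemma Phi_bar_le z : Phi_bar f + (beta - mu^-1) / 2 * enorm (grad_y f z) ^+ 2 <= h z.
Proof.
have : Phi_bar f <= f z + enorm (grad_y f z) ^+ 2 / (2 * mu).
  have [_ _ _ _ _ _ _ lb] := std.
  apply: (@le_trans _ _ (Phi f (lsubmx z))).
    by apply: inf_lbound => //; exists (lsubmx z).
  apply: ge_sup; first by exists (f (row_mx (lsubmx z) 0)); exists 0.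
  move=> _ [y _ <-].
  have eP : row_mx 0 (y - rsubmx z) *m P = row_mx 0 (y - rsubmx z) :> 'rV_(n + m).
    by rewrite mulmx_Pmx row_mxKr.
  have := f_le_grad_y z eP.
  by rewrite -{1}[z]hsubmxK add_row_mx addr0 addrCA subrr addr0.
rewrite /h_reg invfM.
move: (enorm _) (Phi_bar f) (f z) mu^-1 => g p a b; lra.
Qed.

(** Add the tangent inequalities from [z] to [z + t e] and back. *)
Lemma hess_y_le z e : e *m P = e -> dot (e *m hess f z) e <= - mu * enorm e ^+ 2.
Proof.
move=> eP; apply: (@le_of_small _ _ _ (rho / 2 * enorm e ^+ 3)) => t t0 t1.
have tP (s : R) : s *: e *m P = s *: e by rewrite -scalemxAl eP.
have := concave_tangent z (tP t); have := concave_tangent (z + t *: e) (tP (- t)).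
rewrite -addrA -scalerDl subrr scale0r addr0.
rewrite !enormZ normrN (gtr0_norm t0) !exprMn !dotZr => H1 H2.
have := normr_dot_le (grad f (z + t *: e) - grad f z - t *: e *m hess f z) e.
have := ler_wpM2r (enorm_ge0 e) (gtaylor z (t *: e)).
rewrite enormZ (gtr0_norm t0) !(dotDl, dotNl) -scalemxAl dotZl exprMn => H3.
move/le_trans => /(_ _ H3); rewrite ler_norml => /andP[H4 _].
rewrite -(@ler_pM2l _ (t ^+ 2)) ?exprn_gt0//.
have := ler_wpM2l (ltW t0) H4.
move: (f _) (f z) (dot _ e) (dot _ e) (dot _ e) (enorm e) H1 H2 => a b p q r x H1 H2; lra.
Qed.

(** As [beta mu > 1], the term [beta hess f P grad f] of the gradient of [h_reg]
  overcomes [grad f] in the direction [- grad_y f]. *)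
Lemma grad_y_le z : (beta * mu - 1) * enorm (grad_y f z) <= enorm (grad h z).
Proof.
rewrite enorm_grad_y.
have [a0|a0] := eqVneq (enorm (grad f z *m P)) 0.
  by rewrite a0 mulr0 enorm_ge0.
have agt0 : 0 < enorm (grad f z *m P) by rewrite lt_def a0 enorm_ge0.
have aP : grad f z *m P *m P = grad f z *m P by rewrite -mulmxA Pmx_idem.
have H := ler_wpM2l (ltW beta_gt0) (hess_y_le z aP).
rewrite -(ler_pM2r agt0) -[X in _ <= _ * X]enormN.
apply: le_trans (dot_le _ _).
have ga : dot (grad f z) (grad f z *m P) = enorm (grad f z *m P) ^+ 2.
  by rewrite enorm_sqr dot_Pmx dot_Pmxl.
rewrite dotNr grad_h_reg dotDl dotZl ga.
move: (dot _ _) (enorm _) H => p x H; lra.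
Qed.

End Regularized.

(** * Minimizers of a cubic model *)

Section CubicModel.
Context {R : realType} {d : nat} (g : 'rV[R]_d) (A : 'M[R]_d) (sigma : R).
Hypothesis A_sym : A^T = A.
Hypothesis sigma_ge0 : 0 <= sigma.
Implicit Types (xi v : 'rV[R]_d).

Let M xi := dot g xi + dot (xi *m A) xi / 2 + sigma * enorm xi ^+ 3.

Let M_step xi v : M (xi + v) = M xi + dot (g + xi *m A) v + dot (v *m A) v / 2
  + sigma * (enorm (xi + v) ^+ 3 - enorm xi ^+ 3).
Proof.
rewrite /M mulmxDl !(dotDl, dotDr).
have -> : dot (v *m A) xi = dot (xi *m A) v by rewrite dot_mull A_sym dotC.
by field.
Qed.

Lemma enorm_sqrD xi v : enorm (xi + v) ^+ 2
  = enorm xi ^+ 2 + 2 * dot xi v + enorm v ^+ 2.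
Proof. by rewrite !enorm_sqr !(dotDl, dotDr) (dotC v xi); ring. Qed.

(** With [s = |xi + v|] and [r = |xi|], the identity
  [s^3 - r^3 - 3/2 r (s^2 - r^2) = (s - r)^2 (s + r/2)] leaves only terms of
  second order in [v]. *)
Lemma enorm_cubeD_le xi v : enorm (xi + v) ^+ 3 <= enorm xi ^+ 3
  + 3 * enorm xi * dot xi v + enorm v ^+ 2 * (3 * enorm xi + enorm v).
Proof.
have s2 := enorm_sqrD xi v; have sN := ler_enormD xi v.
have rN : enorm xi <= enorm (xi + v) + enorm v.
  by have := ler_enormB (xi + v) v; rewrite addrK.
have r0 := enorm_ge0 xi; have s0 := enorm_ge0 (xi + v); have v0 := enorm_ge0 v.
move: (enorm (xi + v)) (enorm xi) (enorm v) (dot xi v) s2 sN rN r0 s0 v0.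
move=> s r t p s2 sN rN r0 s0 t0.
have sr2 : (s - r) ^+ 2 <= t ^+ 2.
  have : 0 <= (t - (s - r)) * (t + (s - r)) by apply: mulr_ge0; lra.
  lra.
have : (s - r) ^+ 2 * (s + r / 2) <= t ^+ 2 * (3 / 2 * r + t).
  apply: ler_pM; [exact: sqr_ge0 | lra | exact: sr2 | lra].
have -> : s ^+ 3 = r ^+ 3 + 3 / 2 * r * (s ^+ 2 - r ^+ 2)
    + (s - r) ^+ 2 * (s + r / 2) by field.
rewrite s2; lra.
Qed.

Section Minimizer.
Variable xi : 'rV[R]_d.
Hypothesis xi_min : forall xi', M xi <= M xi'.

Lemma cubic_min_le0 : M xi <= 0.
Proof.
by apply: (le_trans (xi_min 0)); rewrite /M mul0mx dotC !dot0l enorm0 expr0n/=; lra.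
Qed.

(** [enorm_cubeD_le] bounds the one-sided directional derivatives of the model by
  an expression linear in the direction; it is nonnegative, hence zero. *)
Lemma cubic_min_stationary : g + xi *m A + (3 * sigma * enorm xi) *: xi = 0.
Proof.
have ge0 v : 0 <= dot (g + xi *m A + (3 * sigma * enorm xi) *: xi) v.
  pose K := dot (v *m A) v / 2 + sigma * (enorm v ^+ 2 * (3 * enorm xi + enorm v)).
  apply: (@le_of_small _ _ _ K) => t t0 t1.
  have := xi_min (xi + t *: v); rewrite M_step -addrA -addrA lerDl.
  have := ler_wpM2l sigma_ge0 (enorm_cubeD_le xi (t *: v)).
  rewrite enormZ gtr0_norm// -scalemxAl !dotZr dotZl [X in 0 <= X]addrC => H1 H2.
  rewrite -(ler_pM2l t0) mulr0 dotDl dotZl /K.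
  have v0 := enorm_ge0 v.
  have : sigma * (t ^+ 3 * enorm v ^+ 3) <= sigma * (t ^+ 2 * enorm v ^+ 3).
    rewrite ler_wpM2l// ler_wpM2r ?exprn_ge0//.
    by rewrite exprS ler_piMl// exprn_ge0// ltW.
  move: (dot _ v) (dot _ v) (dot _ v) (enorm (_ + _)) (enorm v) (enorm xi) H1 H2.
  move=> p q r s x y H1 H2; lra.
apply: dot_eq0; apply/eqP; rewrite eq_le dot_ge0 andbT.
by rewrite -oppr_ge0 -dotNr ge0.
Qed.

(** Compare the minimizer with [xi + w] and [xi - w] for [w] parallel to [v] and
  slightly longer than [xi]: first-order terms cancel, and the parallelogram
  law bounds the two cubes by [8 |w|^3]. *)
Lemma cubic_min_curvature v :
  - (8 * sigma * enorm xi) * enorm v ^+ 2 <= dot (v *m A) v.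
Proof.
have [v0|v0] := eqVneq (enorm v) 0.
  by rewrite (enorm_eq0 v0) mul0mx dot0l enorm0 expr0n/= mulr0.
have vgt0 : 0 < enorm v by rewrite lt_def v0 enorm_ge0.
apply: (@le_of_small _ _ _ (8 * sigma * enorm v ^+ 2)) => t t0 _.
pose q := enorm xi + t; have q0 : 0 < q by rewrite ltr_wpDl ?enorm_ge0.
pose w := (q / enorm v) *: v.
have wq : enorm w = q.
  by rewrite enormZ gtr0_norm ?divr_gt0// divfK.
have := xi_min (xi + w); have := xi_min (xi - w).
rewrite !M_step mulNmx !(dotNl, dotNr) opprK.
have := enorm_sqrD xi w; have := enorm_sqrD xi (- w).
rewrite dotNr enormN wq.
have := ler_enormD xi w; have := ler_enormB xi w; rewrite wq.
have Aw : dot (w *m A) w = (q / enorm v) ^+ 2 * dot (v *m A) v.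
  by rewrite -scalemxAl dotZl dotZr mulrA expr2.
have tq : t = q - enorm xi by rewrite /q addrAC subrr add0r.
rewrite tq.
have := enorm_ge0 (xi + w); have := enorm_ge0 (xi - w); have := enorm_ge0 xi.
move: (enorm (xi + w)) (enorm (xi - w)) (dot xi w) (dot _ w) (dot (w *m A) w)
  (M xi) Aw => s1 s2 p D wAw m Aw r0 s20 s10 sB sD sq2 sq1 le2 le1.
have rq : enorm xi <= q by rewrite /q lerDl ltW.
have sum2 : s1 ^+ 2 + s2 ^+ 2 <= 4 * q ^+ 2.
  have : enorm xi ^+ 2 <= q ^+ 2 by rewrite ler_pXn2r ?nnegrE// ltW.
  by rewrite sq1 sq2; lra.
have cube s : 0 <= s -> s <= enorm xi + q -> s ^+ 3 <= 2 * q * s ^+ 2.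
  by move=> ? ?; rewrite exprS ler_wpM2r ?exprn_ge0//; lra.
have c1 := cube _ s10 sD; have c2 := cube _ s20 sB.
have sum3 : s1 ^+ 3 + s2 ^+ 3 <= 8 * q ^+ 3.
  have := ler_wpM2l (ltW (mulr_gt0 (ltr0Sn R 1) q0)) sum2; lra.
have := ler_wpM2l sigma_ge0 sum3.
have sr : 0 <= sigma * enorm xi ^+ 3 by rewrite mulr_ge0 ?exprn_ge0.
move=> sum3'.
have : - (8 * sigma * q) * q ^+ 2 <= wAw by lra.
have Aw' : wAw * enorm v ^+ 2 = q ^+ 2 * dot (v *m A) v.
  by rewrite Aw; field.
move=> /(ler_wpM2r (sqr_ge0 (enorm v))); rewrite Aw' => H.
rewrite -(@ler_pM2l _ (q ^+ 2)) ?exprn_gt0//.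
lra.
Qed.

End Minimizer.
End CubicModel.

(** * One step of the method *)

Section AcqrnStep.
Context {R : realType} {n m : nat} (f : 'rV[R]_(n + m) -> R) (mu L rho beta : R).
Hypothesis std : standing mu L rho f.
Hypothesis beta_gt : mu^-1 < beta.
Local Notation h := (h_reg beta f).
Local Notation c := ((3 * beta * L + 1) * rho / 6).
Local Notation alpha1 := (2 * beta * rho).
Local Notation alpha2 := (2 * (3 * beta * L + 1) * rho).
Variables z xi : 'rV[R]_(n + m).
Hypothesis xi_min : forall xi',
  acqrn_model beta alpha1 alpha2 f z xi <= acqrn_model beta alpha1 alpha2 f z xi'.

Let rho_gt0 : 0 < rho. Proof. by case: std. Qed.
Let beta_gt0 : 0 < beta.
Proof. by rewrite (lt_trans _ beta_gt)// invr_gt0; case: std. Qed.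
Let c_gt0 : 0 < c. Proof. exact: cubic_coeff_gt0 std beta_gt. Qed.
Let c_ge0 : 0 <= c. Proof. exact: ltW c_gt0. Qed.
Let br_ge0 : 0 <= beta * rho. Proof. by rewrite mulr_ge0// ltW. Qed.

Let sigmaE : alpha2 / 6 = 2 * c. Proof. by field. Qed.

Let A := Hbar beta f z + (alpha1 * enorm (grad_y f z))%:M.

Let A_sym : A^T = A.
Proof. by rewrite /A linearD /= (Hbar_sym beta std) tr_scalar_mx. Qed.

Let sigma_ge0 : 0 <= alpha2 / 6.
Proof. by rewrite sigmaE mulr_ge0// ltW. Qed.

Let mulA (v : 'rV[R]_(n + m)) :
  v *m A = v *m Hbar beta f z + (alpha1 * enorm (grad_y f z)) *: v.
Proof. by rewrite /A mulmxDr mul_mx_scalar. Qed.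

(** The model carries twice the quadratic and the cubic error terms of
  [h_reg_upper], and its minimum is at most its value [0] at [0]. *)
Lemma acqrn_descent : h (z + xi) <= h z - c * enorm xi ^+ 3.
Proof.
have := @cubic_min_le0 _ _ (grad h z) A (alpha2 / 6) xi xi_min.
have := h_reg_upper std beta_gt z xi.
rewrite -/A sigmaE mulA dotDl dotZl -enorm_sqr.
have : 0 <= beta * rho * (enorm (grad_y f z) * enorm xi ^+ 2).
  by rewrite !mulr_ge0 ?exprn_ge0 ?enorm_ge0 ?(ltW beta_gt0) ?(ltW rho_gt0).
move: (h _) (h z) (dot _ xi) (dot _ xi) (enorm _) (enorm xi) => a b p q g x; lra.
Qed.

(** Stationarity replaces [grad h z + xi Hbar] by a multiple of [xi]. *)
Lemma acqrn_grad_le : enorm (grad h (z + xi)) <=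
  9 * c * enorm xi ^+ 2 + 3 * (beta * rho) * enorm (grad_y f z) * enorm xi.
Proof.
have := @cubic_min_stationary _ _ (grad h z) A (alpha2 / 6) A_sym sigma_ge0 xi xi_min.
rewrite sigmaE mulA => st.
have T := grad_h_reg_taylor std beta_gt z xi.
pose s := 2 * (beta * rho) * enorm (grad_y f z) + 6 * c * enorm xi.
have s0 : 0 <= s.
  by apply: addr_ge0; (apply: mulr_ge0; last exact: enorm_ge0); apply: mulr_ge0.
have E : grad h (z + xi) = (grad h (z + xi) - grad h z - xi *m Hbar beta f z) - s *: xi.
  move: st T; move: (grad h (z + xi)) (grad h z) (xi *m Hbar beta f z) => G g w st _.
  have -> : s *: xi = - (g + w).
    apply/eqP; rewrite -addr_eq0; apply/eqP; rewrite -[RHS]st /s.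
    by apply/rowP => j; rewrite !mxE; ring.
  by apply/rowP => j; rewrite !mxE; ring.
rewrite E; apply: (le_trans (ler_enormB _ _)).
apply: (le_trans (lerD T (lexx _))); rewrite enormZ ger0_norm// /s.
by rewrite le_eqVlt; apply/orP; left; apply/eqP; ring.
Qed.

(** The coefficient [22] is [16] from the curvature of the model at [z], plus [6]
  for moving [Hbar] to [z + xi]. *)
Lemma acqrn_hess_ge : - (22 * c * enorm xi + 2 * (beta * rho) * enorm (grad_y f z)
    + beta * rho * enorm (grad_y f (z + xi))) <= lambda_min (hess h (z + xi)).
Proof.
apply: lambda_min_ge => [|v].
  apply: addr_ge0; [apply: addr_ge0|]; (apply: mulr_ge0; last exact: enorm_ge0) => //;
    exact: mulr_ge0.
have H1 := @cubic_min_curvature _ _ (grad h z) A (alpha2 / 6) A_sym sigma_ge0 xi xi_min v.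
rewrite sigmaE mulA dotDl dotZl -enorm_sqr in H1.
have H2 := dot_Hbar_lip std beta_gt z xi v.
have H3 := hess_h_reg_dist std beta_gt (z + xi) v.
have combine (p q r x y g g' : R) :
    - (8 * (2 * c) * x) * y ^+ 2 <= p + alpha1 * g * y ^+ 2 ->
    p - 6 * c * x * y ^+ 2 <= q -> `|r - q| <= beta * rho * g' * y ^+ 2 ->
    - (22 * c * x + 2 * (beta * rho) * g + beta * rho * g') * y ^+ 2 <= r.
  by move=> {}H1 {}H2; rewrite ler_norml => /andP[{}H3 _]; lra.
exact: combine H1 H2 H3.
Qed.

End AcqrnStep.

(** * Sequences with cubic decrease *)

Section DescentSequences.
Context {R : realType}.
Implicit Types (c b kappa eta P Delta : R) (x a g lam hh : nat -> R).

Definition cube_root_rate c Delta (T : nat) : R := (Delta / (c * T%:R)) `^ 3^-1.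

Lemma cube_root_rate_ge0 c Delta T : 0 <= cube_root_rate c Delta T.
Proof. exact: powR_ge0. Qed.

Lemma cube_root_rateK c Delta T : 0 < c -> 0 <= Delta ->
  cube_root_rate c Delta T ^+ 3 = Delta / (c * T%:R).
Proof.
move=> c0 D0; rewrite -powR_mulrn ?powR_ge0// -powRrM mulVf ?pnatr_eq0// powRr1//.
by rewrite divr_ge0// mulr_ge0// ltW.
Qed.

(** What the convergence argument uses of the iterates: the value [hh], step
  length [x], gradient norm [a], norm [g] of the [y]-gradient of the original
  function, and smallest Hessian eigenvalue [lam]. *)
Record descent_data c b kappa eta P x a g lam hh : Prop := DescentData {
  dd_c : 0 < c;
  dd_b : 0 <= b;
  dd_kappa : 0 < kappa;
  dd_eta : 0 < eta;
  dd_x : forall k, 0 <= x k;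
  dd_g : forall k, 0 <= g k;
  dd_descent : forall k, hh k.+1 <= hh k - c * x k ^+ 3;
  dd_lower : forall k, P + kappa / 2 * g k ^+ 2 <= hh k;
  dd_grad : forall k, a k.+1 <= 9 * c * x k ^+ 2 + 3 * b * g k * x k;
  dd_grad_y : forall k, eta * g k <= a k;
  dd_hess : forall k,
    - (22 * c * x k + 2 * b * g k + b * g k.+1) <= lam k.+1
}.

Definition stationarity c (a lam : nat -> R) (k : nat) : R :=
  Num.max (Num.sqrt (a k / c)) (- (lam k / c)).

Lemma min_upto_le (u : nat -> R) (T k : nat) (B : R) :
  (1 <= k <= T)%N -> u k <= B -> min_upto u T <= B.
Proof.
move=> kT uB; apply: bigmin_inf_seq uB => //.
by rewrite mem_index_iota.
Qed.

Section Data.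
Context {c b kappa eta P : R} {x a g lam hh : nat -> R}.
Hypothesis dd : descent_data c b kappa eta P x a g lam hh.
Local Notation Delta := (hh 0%N - P).
Local Notation G := (Num.sqrt (2 * Delta / kappa)).

Let c0 := dd_c dd.
Let b0 := dd_b dd.
Let x0 := dd_x dd.
Let g0 := dd_g dd.

Lemma dd_nonincreasing : nonincreasing_seq hh.
Proof.
apply/nonincreasing_seqP => k; apply: (le_trans (dd_descent dd k)).
by rewrite lerBlDr lerDl mulr_ge0 ?exprn_ge0 ?(ltW c0).
Qed.

Lemma dd_lower_bound k : P <= hh k.
Proof.
apply: le_trans (dd_lower dd k); rewrite lerDl mulr_ge0 ?exprn_ge0//.
by rewrite divr_ge0// ltW// (dd_kappa dd).
Qed.

Lemma dd_Delta_ge0 : 0 <= Delta.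
Proof. by rewrite subr_ge0 dd_lower_bound. Qed.

Lemma dd_g_le k : g k <= G.
Proof.
have k0 := dd_kappa dd.
rewrite -[leLHS]ger0_norm// -sqrtr_sqr ler_wsqrtr// ler_pdivlMr//.
have := dd_lower dd k; have := dd_nonincreasing (leq0n k); lra.
Qed.

Lemma dd_x_le k (B : R) : 0 <= B -> c * x k ^+ 3 <= c * B ^+ 3 -> x k <= B.
Proof. by move=> B0; rewrite ler_pM2l// ler_pXn2r// nnegrE. Qed.

Lemma dd_x_cvg : x @ \oo --> (0 : R).
Proof.
have hcvg : hh @ \oo --> limn hh.
  apply: nonincreasing_is_cvgn; first exact: dd_nonincreasing.
  by exists P => _ [k _ <-]; exact: dd_lower_bound.
have dcvg : (fun k => hh k - hh k.+1) @ \oo --> (0 : R).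
  rewrite -(subrr (limn hh)); apply: cvgB => //.
  by move: hcvg; rewrite -cvg_shiftS.
apply/cvgrPdist_lt => e e0.
have ce : 0 < c * e ^+ 3 by rewrite mulr_gt0// exprn_gt0.
have /cvgrPdist_lt /(_ _ ce) := dcvg.
apply: filterS => k; rewrite !sub0r !normrN (ger0_norm (x0 k)) => H.
rewrite ltNge; apply/negP => ex; move: H; rewrite ltNge => /negP; apply.
apply: le_trans (ler_norm _).
have : c * e ^+ 3 <= c * x k ^+ 3.
  by rewrite ler_pM2l// ler_pXn2r// nnegrE// ltW.
have := dd_descent dd k; lra.
Qed.

(** Over [N] consecutive blocks of three steps the decrease is at most [Delta],
  so some block has all three steps short. *)
Lemma dd_short_block N : (0 < N)%N -> exists2 j, (j < N)%N &
  forall i, (i < 3)%N -> c * x (3 * j + i)%N ^+ 3 <= Delta / N%:R.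
Proof.
move=> N0; have Npos : 0 < N%:R :> R by rewrite ltr0n.
apply: contrapT => /forall2NP no.
have step j : (j < N)%N -> hh (3 * j.+1)%N < hh (3 * j)%N - Delta / N%:R.
  move=> jN; have [//|] := no j => /existsNP[i /not_implyP[i3 /negP]].
  rewrite -ltNge => xi.
  have p k : 0 <= c * x k ^+ 3 by rewrite mulr_ge0 ?exprn_ge0 ?(ltW c0).
  have d0 := dd_descent dd (3 * j)%N; have d1 := dd_descent dd (3 * j).+1.
  have d2 := dd_descent dd (3 * j).+2.
  have p0 := p (3 * j)%N; have p1 := p (3 * j).+1; have p2 := p (3 * j).+2.
  rewrite mulnS -[(3 + _)%N]/((3 * j).+3).
  by case: i i3 xi => [|[|[|//]]] _; rewrite ?addn0 ?addn1 ?addn2; lra.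
have tele j : (j < N)%N -> hh (3 * j.+1)%N < hh 0%N - j.+1%:R * (Delta / N%:R).
  elim: j => [|j IH] jN; first by have := step 0%N jN; rewrite muln0; lra.
  have := step _ jN; have := IH (ltnW jN); rewrite -[j.+2%:R]natr1; lra.
have := tele N.-1; rewrite prednK// leqnn mulrCA divff ?gt_eqF// mulr1 => /(_ isT).
have := dd_lower_bound N; have := dd_lower_bound (3 * N)%N; lra.
Qed.

Lemma dd_grad_le k (w B : R) : x k <= w -> g k <= B ->
  a k.+1 <= 9 * c * w ^+ 2 + 3 * b * B * w.
Proof.
move=> xw gB; apply: (le_trans (dd_grad dd k)).
have w0 := le_trans (x0 k) xw.
apply: lerD.
  by rewrite ler_wpM2l ?mulr_ge0 ?(ltW c0)// ler_pXn2r// nnegrE.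
by rewrite -!mulrA !ler_wpM2l// ler_pM.
Qed.

Lemma dd_g_le_of_grad k (B : R) : a k <= eta * B -> g k <= B.
Proof. by move/(le_trans (dd_grad_y dd k)); rewrite ler_pM2l ?(dd_eta dd). Qed.

Lemma dd_grad_cvg : a @ \oo --> (0 : R).
Proof.
have xc := dd_x_cvg.
have xc2 : (fun k => 9 * c * x k ^+ 2 + 3 * b * G * x k) @ \oo --> (0 : R).
  rewrite -[X in _ --> X](_ : 9 * c * 0 ^+ 2 + 3 * b * G * 0 = 0);
    last by rewrite expr0n/=; ring.
  by apply: cvgD; apply: cvgMr => //; rewrite !expr2; apply: cvgM.
rewrite -cvg_shiftS; apply: (squeeze_cvgr _ (cvg_cst (0 : R)) xc2).
apply: nearW => k /=; rewrite dd_grad_le ?dd_g_le// andbT.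
apply: le_trans (dd_grad_y dd k.+1).
by rewrite mulr_ge0// ltW// (dd_eta dd).
Qed.

Lemma dd_g_cvg : g @ \oo --> (0 : R).
Proof.
have ac : (fun k => eta^-1 * a k) @ \oo --> (0 : R).
  by rewrite -(mulr0 eta^-1); apply: cvgMr => //; exact: dd_grad_cvg.
apply: (squeeze_cvgr _ (cvg_cst (0 : R)) ac).
apply: nearW => k /=; rewrite g0/=.
by apply: dd_g_le_of_grad; rewrite mulVKf// gt_eqF// (dd_eta dd).
Qed.

Lemma dd_hess_liminf : (0 <= limn_einf (fun k => (lam k)%:E))%E.
Proof.
pose e k := 22 * c * x k + 2 * b * g k + b * g k.+1.
have ec : e @ \oo --> (0 : R).
  rewrite -[X in _ --> X](_ : 22 * c * 0 + 2 * b * 0 + b * 0 = 0); last by ring.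
  have gs : (fun k => g k.+1) @ \oo --> (0 : R).
    by have := dd_g_cvg; rewrite -cvg_shiftS.
  by apply: cvgD; [apply: cvgD|]; apply: cvgMr => //; [exact: dd_x_cvg | exact: dd_g_cvg].
rewrite limn_einf_lim; apply/lee_addgt0Pr => d d0.
rewrite -leeBlDr// sub0e -EFinN.
apply: lime_ge; first exact: is_cvg_einfs.
have /cvgrPdist_lt /(_ _ d0) [N _ eN] := ec.
exists N.+1 => // m /= Nm; apply: le_ereal_inf_tmp => _ [k /= mk <-].
rewrite lee_fin; case: k mk => [|k] mk; first by move: (leq_trans Nm mk).
have := eN k (leq_trans Nm mk : (N <= k)%N); rewrite /= sub0r normrN.
move=> /(le_lt_trans (ler_norm _)).
have := dd_hess dd k; rewrite -/(e k) => H1 H2.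
by apply: le_trans H1; rewrite lerN2 ltW.
Qed.

End Data.

(** If three consecutive steps have length at most [w], then [g <= K1 w] after the
  first and [g <= K2 w^2] after the second; this bound on [w] makes the terms
  in [g] after the third at most [c w^2] in the gradient and [c w] in the
  curvature. *)
Definition short_step c b kappa eta Delta : R :=
  let K1 := (9 * c + 3 * b * Num.sqrt (2 * Delta / kappa)) / eta in
  let K2 := (9 * c + 3 * b * K1) / eta in
  c / (c + 3 * b * K2 + 10 * b * c / eta).

Lemma short_step_gt0 c b kappa eta Delta : 0 < c -> 0 <= b -> 0 < eta ->
  0 < short_step c b kappa eta Delta.
Proof.
move=> c0 b0 e0; have c0' := ltW c0; have e0' := ltW e0; rewrite /short_step.
set G := Num.sqrt _; set K1 := ((9 * c + 3 * b * G) / eta).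
set K2 := ((9 * c + 3 * b * K1) / eta).
have K10 : 0 <= K1.
  by rewrite divr_ge0// addr_ge0// ?mulr_ge0 ?mulr_ge0 ?sqrtr_ge0.
have K20 : 0 <= K2.
  by apply: divr_ge0 => //; apply: addr_ge0; apply: mulr_ge0 => //; apply: mulr_ge0.
have K30 : 0 <= 10 * b * c / eta by rewrite divr_ge0// ?mulr_ge0 ?mulr_ge0.
have bK2 := mulr_ge0 b0 K20.
by rewrite divr_gt0//; lra.
Qed.

Section Window.
Context {c b kappa eta P : R} {x a g lam hh : nat -> R}.
Hypothesis dd : descent_data c b kappa eta P x a g lam hh.
Local Notation Delta := (hh 0%N - P).

(** The [y]-gradient is a priori only bounded, so after one short step the
  gradient is [O(w)]; it then controls the [y]-gradient, and two further short
  steps make the gradient at most [10 c w^2].  The factor [23] is the [22] of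
  [dd_hess] plus [1] for the terms in [g]. *)
Lemma stationarity_window k (w : R) :
  x k <= w -> x k.+1 <= w -> x k.+2 <= w -> w <= short_step c b kappa eta Delta ->
  stationarity c a lam k.+3 <= 23 * w.
Proof.
move=> xw0 xw1 xw2; rewrite /short_step.
have c0 := dd_c dd; have b0 := dd_b dd; have e0 := dd_eta dd.
have w0 := le_trans (dd_x dd k) xw0.
set G := Num.sqrt _; set K1 := ((9 * c + 3 * b * G) / eta).
set K2 := ((9 * c + 3 * b * K1) / eta) => wle.
have G0 : 0 <= G := sqrtr_ge0 _.
have K1E : eta * K1 = 9 * c + 3 * b * G by rewrite /K1 mulrC divfK// gt_eqF.
have K2E : eta * K2 = 9 * c + 3 * b * K1 by rewrite /K2 mulrC divfK// gt_eqF.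
have K10 : 0 <= K1.
  rewrite -(pmulr_rge0 _ e0) K1E.
  by apply: addr_ge0; apply: mulr_ge0 => //; [exact: ltW | exact: mulr_ge0].
have K20 : 0 <= K2.
  rewrite -(pmulr_rge0 _ e0) K2E.
  by apply: addr_ge0; apply: mulr_ge0 => //; [exact: ltW | exact: mulr_ge0].
pose K3 := 10 * c / eta.
have K3E : eta * K3 = 10 * c by rewrite /K3 mulrC divfK// gt_eqF.
have K30 : 0 <= K3 by rewrite -(pmulr_rge0 _ e0) K3E mulr_ge0// ltW.
have bK2 := mulr_ge0 b0 K20; have bK3 := mulr_ge0 b0 K30.
move: wle; rewrite (_ : 10 * b * c / eta = b * K3); last by rewrite /K3; ring.
rewrite ler_pdivlMr => [wle|]; last by lra.
have wc : 0 <= w * c by rewrite mulr_ge0// ltW.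
have wbK2 : 0 <= w * (b * K2) by rewrite mulr_ge0.
have wbK3 : 0 <= w * (b * K3) by rewrite mulr_ge0.
have w1 : w <= 1 by rewrite -(ler_pM2r c0); lra.
have w2 : w ^+ 2 <= w by rewrite expr2 ler_piMl.
have w20 : 0 <= w ^+ 2 by rewrite exprn_ge0.
have gk : g k <= G := dd_g_le dd k.
clearbody K1 K2 K3 G.
have g1 : g k.+1 <= K1 * w.
  apply: (dd_g_le_of_grad dd); apply: (le_trans (dd_grad_le dd xw0 gk)).
  rewrite [eta * (_ * _)]mulrA K1E; have := ler_wpM2l (ltW c0) w2; lra.
have g2 : g k.+2 <= K2 * w ^+ 2.
  apply: (dd_g_le_of_grad dd); apply: (le_trans (dd_grad_le dd xw1 g1)).
  by rewrite [eta * (_ * _)]mulrA K2E; lra.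
have a3 : a k.+3 <= 10 * c * w ^+ 2.
  apply: (le_trans (dd_grad_le dd xw2 g2)).
  have : (w * (3 * (b * K2))) * w ^+ 2 <= c * w ^+ 2 by rewrite ler_wpM2r//; lra.
  lra.
have g3 : g k.+3 <= K3 * w ^+ 2.
  by apply: (dd_g_le_of_grad dd); rewrite [eta * (_ * _)]mulrA K3E.
rewrite /stationarity ge_max; apply/andP; split.
  have w23 : 0 <= 23 * w by rewrite mulr_ge0.
  rewrite -[leRHS]ger0_norm// -sqrtr_sqr ler_wsqrtr// ler_pdivrMr//.
  apply: (le_trans a3); have := mulr_ge0 (ltW c0) w20; lra.
rewrite lerNl -mulNr ler_pdivlMr//.
have := dd_hess dd k.+2.
have h2 := ler_wpM2l b0 g2; have h3 := ler_wpM2l b0 g3.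
have hx := ler_wpM2l (ltW c0) xw2.
have : (w * (2 * (b * K2) + b * K3)) * w <= c * w by rewrite ler_wpM2r//; lra.
lra.
Qed.

(** Uses only the a priori bounds [X] on the first step and [G] on the
  [y]-gradient; both vanish when [Delta = 0]. *)
Lemma stationarity_first : stationarity c a lam 1 <=
  let X := cube_root_rate c Delta 1 in let G := Num.sqrt (2 * Delta / kappa) in
  Num.max (Num.sqrt ((9 * c * X ^+ 2 + 3 * b * G * X) / c))
    ((22 * c * X + 3 * b * G) / c).
Proof.
have c0 := dd_c dd; have b0 := dd_b dd.
set X := cube_root_rate _ _ _ => /=; set G := Num.sqrt (2 * Delta / kappa).
have xX : x 0%N <= X.
  apply: (dd_x_le dd); first exact: cube_root_rate_ge0.
  rewrite cube_root_rateK ?(dd_Delta_ge0 dd)//.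
  have -> : c * (Delta / (c * 1%:R)) = Delta by field; rewrite gt_eqF.
  have := dd_descent dd 0; have := dd_lower_bound dd 1; lra.
rewrite /stationarity ge_max !le_max; apply/andP; split; apply/orP.
  left; rewrite ler_wsqrtr// ler_pM2r ?invr_gt0//.
  have gG : g 0%N <= G := dd_g_le dd 0.
  exact: (dd_grad_le dd xX gG).
right; rewrite -mulNr ler_pM2r ?invr_gt0//.
have := dd_hess dd 0.
have := ler_wpM2l b0 (dd_g_le dd 0); have := ler_wpM2l b0 (dd_g_le dd 1).
have := ler_wpM2l (ltW c0) xX; rewrite -/G; lra.
Qed.

(** With the bound [2 (Delta / (c T))^(1/3)] on a block of short steps, the factor
  [23] of [stationarity_window] becomes [46]. *)
Lemma min_stationarity_large T : (3 <= T)%N ->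
  8 * Delta / (c * short_step c b kappa eta Delta ^+ 3) <= T%:R ->
  min_upto (stationarity c a lam) T <= 46 * cube_root_rate c Delta T.
Proof.
move=> T3; set d := short_step _ _ _ _ _ => dT.
have c0 := dd_c dd; have D0 := dd_Delta_ge0 dd.
have d0 : 0 < d by apply: short_step_gt0; [exact: dd_c dd|exact: dd_b dd|exact: dd_eta dd].
have Tpos : 0 < T%:R :> R by rewrite ltr0n (leq_trans _ T3).
set q := cube_root_rate _ _ _; have q0 : 0 <= q := cube_root_rate_ge0 _ _ _.
have q3 : c * q ^+ 3 = Delta / T%:R.
  by rewrite cube_root_rateK// invfM mulrCA mulVKf ?gt_eqF.
have N0 : (0 < T %/ 3)%N by rewrite divn_gt0.
have [j jN short] := dd_short_block dd N0.
have xw i : (i < 3)%N -> x (3 * j + i)%N <= 2 * q.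
  move=> i3; apply: (dd_x_le dd); first by rewrite mulr_ge0.
  apply: (le_trans (short i i3)); rewrite exprMn mulrCA q3.
  (* On the block [c x^3 <= Delta / (T %/ 3)], hence at most [8 Delta / T]. *)
  have TN : T%:R <= 8 * (T %/ 3)%:R :> R.
    have : T%:R <= ((T %/ 3).+1 * 3)%:R :> R by rewrite ler_nat ltnW// ltn_ceil.
    have : 1 <= (T %/ 3)%:R :> R by rewrite ler1n.
    rewrite natrM -natr1; lra.
  rewrite ler_pdivrMr ?ltr0n// mulrAC.
  rewrite mulrA ler_pdivlMr// (_ : 2 ^+ 3 = 8)//; last by ring.
  have := ler_wpM2l D0 TN; lra.
have wd : 2 * q <= d.
  have q20 : 0 <= 2 * q by rewrite mulr_ge0.
  rewrite -(@ler_pXn2r _ 3) ?nnegrE ?(ltW d0)//.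
  rewrite -(ler_pM2l c0) exprMn mulrCA q3 mulrA ler_pdivrMr//.
  move: dT; rewrite ler_pdivrMr; last by apply: mulr_gt0 => //; exact: exprn_gt0.
  by rewrite (_ : 2 ^+ 3 = 8)//; [lra|ring].
have := xw 0%N isT; have := xw 1%N isT; have := xw 2%N isT.
rewrite addn0 addn1 addn2 => xw2 xw1 xw0.
have le := stationarity_window xw0 xw1 xw2 wd.
apply: (@min_upto_le _ _ (3 * j).+3); last first.
  by apply: (le_trans le); lra.
rewrite -[(3 * j).+3]/(3 + 3 * j)%N -mulnS /= (leq_trans _ (leq_trunc_div T 3))// mulnC.
by rewrite leq_mul2r jN orbT.
Qed.

End Window.

Lemma min_stationarity_rate c b kappa eta Delta :
  (exists T0 : nat, forall P x a g lam hh,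
    descent_data c b kappa eta P x a g lam hh -> hh 0%N - P = Delta ->
    forall T, (1 <= T)%N -> (T0 <= T)%N ->
    min_upto (stationarity c a lam) T <= 46 * cube_root_rate c Delta T) /\
  (exists2 C', 0 < C' & forall P x a g lam hh,
    descent_data c b kappa eta P x a g lam hh -> hh 0%N - P = Delta ->
    forall T, (1 <= T)%N ->
    min_upto (stationarity c a lam) T <= C' * cube_root_rate c Delta T).
Proof.
pose T0 := maxn 3 (Num.truncn (8 * Delta / (c * short_step c b kappa eta Delta ^+ 3))).+1.
have large P x a g lam hh : descent_data c b kappa eta P x a g lam hh ->
    hh 0%N - P = Delta -> forall T, (T0 <= T)%N ->
    min_upto (stationarity c a lam) T <= 46 * cube_root_rate c Delta T.
  move=> dd DE T; rewrite geq_max => /andP[T3 TT].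
  rewrite -DE; apply: (min_stationarity_large dd T3); rewrite DE.
  by apply: (le_trans (ltW (truncnS_gt _))); rewrite ler_nat.
split; first by exists T0 => P x a g lam hh dd DE T _; exact: large dd DE T.
(* For [T < T0] the rate is at least its value at [T0]; if [Delta = 0] both the
   rate and the a priori bound [B] are [0]. *)
pose X := cube_root_rate c Delta 1; pose G := Num.sqrt (2 * Delta / kappa).
pose B := Num.max (Num.sqrt ((9 * c * X ^+ 2 + 3 * b * G * X) / c))
    ((22 * c * X + 3 * b * G) / c).
have B0 : 0 <= B by rewrite le_max sqrtr_ge0.
pose q0 := cube_root_rate c Delta T0.
exists (46 + B / q0).
  by rewrite ltr_wpDr// divr_ge0// cube_root_rate_ge0.
move=> P x a g lam hh dd DE T T1.
have qT := cube_root_rate_ge0 c Delta T.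
have [T0T|TT0] := leqP T0 T.
  apply: (le_trans (large _ _ _ _ _ _ dd DE T T0T)).
  by rewrite ler_wpM2r// lerDl divr_ge0// cube_root_rate_ge0.
apply: (@le_trans _ _ B).
  apply: (@min_upto_le _ _ 1); first by rewrite T1.
  by have := stationarity_first dd; rewrite DE.
have c0 := dd_c dd; have D0 := dd_Delta_ge0 dd; rewrite DE in D0.
have [DZ|DN] := eqVneq Delta 0.
  have Z k : cube_root_rate c Delta k = 0.
    by rewrite /cube_root_rate DZ mul0r powR0// invr_eq0 pnatr_eq0.
  rewrite /B /G /X !Z DZ !(mulr0, mul0r, expr0n, addr0, sqrtr0)/=.
  by rewrite ?(mulr0, mul0r, addr0, sqrtr0) ?maxxx.
have Dpos : 0 < Delta by rewrite lt_def DN.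
have T0gt0 : (0 < T0)%N by rewrite leq_max.
have T0pos : 0 < T0%:R :> R by rewrite ltr0n.
have q00 : 0 < q0 by rewrite powR_gt0// divr_gt0// mulr_gt0.
have qq : q0 <= cube_root_rate c Delta T.
  apply: ge0_ler_powR; rewrite ?invr_ge0 ?nnegrE ?divr_ge0 ?mulr_ge0 ?(ltW c0)//.
  rewrite ler_wpM2l// lef_pV2 ?posrE ?mulr_gt0 ?ltr0n//.
  by rewrite ler_wpM2l ?(ltW c0)// ler_nat ltnW.
have Bq0 : 0 <= B / q0 by rewrite divr_ge0// ltW.
have -> : B = B / q0 * q0 by rewrite divfK// gt_eqF.
have := ler_wpM2l Bq0 qq; rewrite divfK ?gt_eqF// mulrDl; lra.
Qed.

End DescentSequences.

(** * Convergence and rate *)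

(** The step is recovered as [z k.+1 - z k], so that no minimizers have to be
  chosen. *)
Lemma acqrn_descent_data {R : realType} {n m : nat} (f : 'rV[R]_(n + m) -> R)
    (mu L rho beta : R) (z : nat -> 'rV[R]_(n + m)) :
  standing mu L rho f -> mu^-1 < beta ->
  acqrn beta (2 * beta * rho) (2 * (3 * beta * L + 1) * rho) f z ->
  let h := h_reg beta f in
  descent_data ((3 * beta * L + 1) * rho / 6) (beta * rho) (beta - mu^-1)
    (beta * mu - 1) (Phi_bar f)
    (fun k => enorm (z k.+1 - z k)) (fun k => enorm (grad h (z k)))
    (fun k => enorm (grad_y f (z k))) (fun k => lambda_min (hess h (z k)))
    (fun k => h (z k)).
Proof.
move=> std beta_gt zA h.
have mu0 : 0 < mu by case: std.
have rho0 : 0 < rho by case: std.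
have beta0 : 0 < beta by rewrite (lt_trans _ beta_gt)// invr_gt0.
have zS k : z k.+1 = z k + (z k.+1 - z k) by rewrite addrC subrK.
have z_min k : forall xi',
    acqrn_model beta (2 * beta * rho) (2 * (3 * beta * L + 1) * rho) f (z k) (z k.+1 - z k)
    <= acqrn_model beta (2 * beta * rho) (2 * (3 * beta * L + 1) * rho) f (z k) xi'.
  by have [xi [xi_min ->]] := zA k; rewrite [z k + xi]addrC addrK.
split=> [||||k|k|k|k|k|k|k].
- exact: (cubic_coeff_gt0 std beta_gt).
- by rewrite mulr_ge0// ltW.
- by rewrite subr_gt0.
- by rewrite subr_gt0 -ltr_pdivrMr// mul1r.
- exact: enorm_ge0.
- exact: enorm_ge0.
- have := acqrn_descent std beta_gt (z_min k); by rewrite -zS.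
- exact: (Phi_bar_le _ std (z k)).
- have := acqrn_grad_le std beta_gt (z_min k); by rewrite -zS.
- exact: (grad_y_le std beta_gt (z k)).
- have := acqrn_hess_ge std beta_gt (z_min k); by rewrite -zS.
Qed.

Theorem theorem3p9 (R : realType) :
  exists2 C : R, 0 < C &
  forall (n m : nat) (f : 'rV[R]_(n + m) -> R) (mu L rho beta : R),
    (0 < n)%N -> (0 < m)%N ->
    standing mu L rho f ->
    mu^-1 < beta ->
    let c := (3 * beta * L + 1) * rho / 6 in
    let alpha1 := 2 * beta * rho in
    let alpha2 := 2 * (3 * beta * L + 1) * rho in
    let h := h_reg beta f in
    (forall z : nat -> 'rV[R]_(n + m), acqrn beta alpha1 alpha2 f z ->
       exists hstar : R,
         [/\ Phi_bar f <= hstar,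
             (fun k => h (z k)) @ \oo --> hstar,
             (fun k => grad h (z k)) @ \oo --> (0 : 'rV[R]_(n + m)) &
             (0 <= limn_einf (fun k => (lambda_min (hess h (z k)))%:E))%E])
    /\
    (forall Delta0 : R,
       (exists T0 : nat,
          forall z : nat -> 'rV[R]_(n + m), acqrn beta alpha1 alpha2 f z ->
            h (z 0%N) - Phi_bar f = Delta0 ->
            forall T : nat, (1 <= T)%N -> (T0 <= T)%N ->
              min_upto (fun k => opt_measure beta c f (z k)) T
              <= C * (Delta0 / (c * T%:R)) `^ (3^-1))
       /\
       (exists2 C' : R, 0 < C' &
          forall z : nat -> 'rV[R]_(n + m), acqrn beta alpha1 alpha2 f z ->
            h (z 0%N) - Phi_bar f = Delta0 ->
            forall T : nat, (1 <= T)%N ->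
              min_upto (fun k => opt_measure beta c f (z k)) T
              <= C' * (Delta0 / (c * T%:R)) `^ (3^-1))).
Proof.
exists 46 => // n m f mu L rho beta _ _ std beta_gt c alpha1 alpha2 h.
have data (z : nat -> 'rV[R]_(n + m)) :=
  @acqrn_descent_data R n m f mu L rho beta z std beta_gt.
split=> [z /data dd|Delta0].
  exists (limn (fun k => h (z k))).
  have hc : (fun k => h (z k)) @ \oo --> limn (fun k => h (z k)).
    apply: nonincreasing_is_cvgn; first exact: dd_nonincreasing dd.
    by exists (Phi_bar f) => _ [k _ <-]; exact: dd_lower_bound dd k.
  split=> //.
  - apply: limr_ge; first exact: cvgP hc.
    by apply: nearW => k; exact: dd_lower_bound dd k.
  - apply/cvgrPdist_lt => e e0.
    have /cvgrPdist_lt /(_ e e0) := dd_grad_cvg dd.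
    apply: filterS => k; rewrite !sub0r !normrN; apply: le_lt_trans.
    by apply: (le_trans (normr_le_enorm _)); exact: ler_norm.
  - exact: dd_hess_liminf dd.
have [[T0 large] [C' C'0 all]] := min_stationarity_rate c (beta * rho)
  (beta - mu^-1) (beta * mu - 1) Delta0.
split; first by exists T0 => z /data dd DE; exact: large dd DE.
by exists C' => // z /data dd DE; exact: all dd DE.
Qed.
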